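(* If $A$ is a sufficient enlargement of minimal volume for $l_2^n$ (that is, $A$ is a sufficient enlargement for $l_2^n$ whose volume is the smallest among the volumes of all sufficient enlargements for $l_2^n$), then $A$ is a cube circumscribed about $B(l_2^n)$.
   Context: All spaces are real; $l_2^n$ is $\mathbb{R}^n$ with the Euclidean norm. $B(X)$ denotes the (closed) unit ball of a normed space $X$. A cube circumscribed about $B(l_2^n)$ is a set of the form $\{x:\ |\langle x,w_i\rangle|\le 1,\ i=1,\dots,n\}$ for some orthonormal basis $w_1,\dots,w_n$ of $\mathbb{R}^n$. A ball in a finite dimensional linear space means a bounded closed convex set with nonempty interior that is symmetric with respect to $0$. A ball $A$ in a finite dimensional normed space $X$ is called a sufficient enlargement for $X$ if for every Banach space $Y$ and every isometric linear embedding of $X$ into $Y$ (identify $X$ with its image) there exists a continuous linear projection $P:Y\to X$ onto $X$ such that $P(B(Y))\subset A$. *)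

(* Defs.v *)
From HB Require Import structures.
From mathcomp Require Import all_boot all_order all_algebra.
From mathcomp Require Import ring.
From mathcomp Require Import all_classical all_reals all_analysis.

Set Implicit Arguments.
Unset Strict Implicit.
Unset Printing Implicit Defensive.

Import Order.TTheory GRing.Theory Num.Theory.
Import numFieldNormedType.Exports.

Local Open Scope classical_set_scope.
Local Open Scope ring_scope.

(* An alias of 'rV[R]_n: the library norms 'rV[R]_n by the sup norm. *)
Definition l2 (R : realType) (n : nat) : Type := 'rV[R]_n.

HB.instance Definition _ (R : realType) (n : nat) :=
  GRing.Lmodule.on (l2 R n).

Definition dot (R : realType) (n : nat) (x y : l2 R n) : R :=
  \sum_(i < n) x ord0 i * y ord0 i.

Section EuclideanNorm.
Variables (R : realType) (n : nat).
Implicit Types (x y z : l2 R n) (a : R).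

Definition l2norm x : R := Num.sqrt (dot x x).

Lemma dotC x y : dot x y = dot y x.
Proof. by apply: eq_bigr => i _; rewrite mulrC. Qed.

Lemma dotDl x y z : dot (x + y) z = dot x z + dot y z.
Proof. by rewrite -big_split; apply: eq_bigr => i _; rewrite mxE mulrDl. Qed.

Lemma dotZl a x y : dot (a *: x) y = a * dot x y.
Proof. by rewrite mulr_sumr; apply: eq_bigr => i _; rewrite mxE mulrA. Qed.

Lemma dot_ge0 x : 0 <= dot x x.
Proof. by apply: sumr_ge0 => i _; rewrite -expr2 sqr_ge0. Qed.

Lemma dot_eq0 x : dot x x = 0 -> x = 0.
Proof.
move/eqP; rewrite psumr_eq0 => [/allP x0|i _]; last by rewrite -expr2 sqr_ge0.
apply/rowP => i; rewrite mxE; apply/eqP.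
by have := x0 i (mem_index_enum _); rewrite mulf_eq0 orbb.
Qed.

Lemma l2norm_ge0 x : 0 <= l2norm x.
Proof. exact: sqrtr_ge0. Qed.

Lemma sqr_l2norm x : l2norm x ^+ 2 = dot x x.
Proof. by rewrite sqr_sqrtr ?dot_ge0. Qed.

Lemma l2norm_eq0 x : l2norm x = 0 -> x = 0.
Proof. by move=> x0; apply: dot_eq0; rewrite -sqr_l2norm x0 expr0n. Qed.

Lemma l2normZ a x : l2norm (a *: x) = `|a| * l2norm x.
Proof.
by rewrite /l2norm dotZl dotC dotZl mulrA -expr2 sqrtrM ?sqr_ge0// sqrtr_sqr.
Qed.

Lemma dot_le_l2norm x y : dot x y <= l2norm x * l2norm y.
Proof.
have dot0 z : dot 0 z = 0 by rewrite /dot big1// => i _; rewrite mxE mul0r.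
have [/l2norm_eq0 ->|x0] := eqVneq (l2norm x) 0.
  by rewrite dot0 mulr_ge0 ?l2norm_ge0.
have [/l2norm_eq0 ->|y0] := eqVneq (l2norm y) 0.
  by rewrite dotC dot0 mulr_ge0 ?l2norm_ge0.
set a := l2norm x in x0 *; set b := l2norm y in y0 *.
have ab0 : 0 < a * b by rewrite mulr_gt0// lt_neqAle eq_sym ?x0 ?y0 l2norm_ge0.
have := dot_ge0 (b *: x + (- a) *: y).
rewrite dotDl !dotZl ![dot _ (_ + _)]dotC !dotDl !dotZl -!sqr_l2norm -/a -/b.
rewrite [dot y x]dotC => h.
have : 0 <= (a * b) * (a * b - dot x y) *+ 2.
  rewrite (le_trans h)// le_eqVlt; apply/orP; left; apply/eqP.
  by move: (dot x y) => c; rewrite !expr2; ring.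
by rewrite pmulrn_lge0// pmulr_rge0// subr_ge0.
Qed.

Lemma ler_l2normD x y : l2norm (x + y) <= l2norm x + l2norm y.
Proof.
rewrite -(ler_pXn2r (n := 2))// ?nnegrE ?addr_ge0 ?l2norm_ge0//.
have -> : l2norm (x + y) ^+ 2 = l2norm x ^+ 2 + dot x y *+ 2 + l2norm y ^+ 2.
  rewrite !sqr_l2norm dotDl ![dot _ (x + y)]dotC !dotDl [dot y x]dotC.
  by move: (dot _ _) (dot _ _) (dot _ _) => a b c; ring.
rewrite sqrrD lerD2r lerD2l ler_wMn2r//.
exact: dot_le_l2norm.
Qed.

End EuclideanNorm.

HB.instance Definition _ (R : realType) (n : nat) :=
  Lmodule_isNormed.Build R (l2 R n)
    (@ler_l2normD R n) (@l2normZ R n) (@l2norm_eq0 R n).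

Lemma l2_normE (R : realType) (n : nat) (x : l2 R n) :
  `|x| = Num.sqrt (\sum_(i < n) x ord0 i ^+ 2).
Proof. by []. Qed.

(* R^n as the iterated product R * (R * ( ... * unit)), with the product of the
   Borel sigma-algebras. *)
Fixpoint Rn_display (R : realType) (n : nat) : measure_display :=
  match n with
  | 0 => default_measure_display
  | m.+1 => (sigma_display R.-ocitv.-measurable, Rn_display R m).-prod%mdisp
  end.

Fixpoint Rn (R : realType) (n : nat) : measurableType (Rn_display R n) :=
  match n with
  | 0 => unit
  | m.+1 => (measurableTypeR R * Rn R m)%type
  end.

(* The library's sigma-finite instance for m1 \x m2 is shadowed by the one for
   sub-probabilities, hence this copy. *)
Section SigmaFiniteProduct.
Local Open Scope ereal_scope.
Context d1 d2 (T1 : measurableType d1) (T2 : measurableType d2) (R : realType).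
Variable m1 : {sigma_finite_measure set T1 -> \bar R}.
Variable m2 : {sigma_finite_measure set T2 -> \bar R}.

Definition sigma_finite_product : set (T1 * T2) -> \bar R := m1 \x m2.

HB.instance Definition _ := Measure.copy sigma_finite_product (m1 \x m2).

Let sigma_finite_productT : sigma_finite setT sigma_finite_product.
Proof.
have /sigma_finiteP[F [TF ndF Foo]] := sigma_finiteT m1.
have /sigma_finiteP[G [TG ndG Goo]] := sigma_finiteT m2.
exists (fun n => F n `*` G n).
  rewrite -setXTT TF TG predeqE => -[x y]; split.
    move=> [/= [n _ Fnx] [k _ Gky]]; exists (maxn n k) => //; split.
    - by move: x Fnx; exact/subsetPset/ndF/leq_maxl.
    - by move: y Gky; exact/subsetPset/ndG/leq_maxr.
  by move=> [n _ []/= ? ?]; split; exists n.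
move=> k; have [? ?] := Foo k; have [? ?] := Goo k.
split; first exact: measurableX.
by rewrite /sigma_finite_product product_measure1E// lte_mul_pinfty//
  ge0_fin_numE.
Qed.

HB.instance Definition _ := Measure_isSigmaFinite.Build _ _ _
  sigma_finite_product sigma_finite_productT.

End SigmaFiniteProduct.

Fixpoint lebesgue_Rn (R : realType) (n : nat) :
    {sigma_finite_measure set (Rn R n) -> \bar R} :=
  match n return {sigma_finite_measure set (Rn R n) -> \bar R} with
  | 0 => [the {sigma_finite_measure set unit -> \bar R} of @dirac _ unit tt R]
  | m.+1 =>
    [the {sigma_finite_measure set (measurableTypeR R * Rn R m)%type -> \bar R}
     of sigma_finite_product (@lebesgue_measure R) (lebesgue_Rn R m)]
  end.

Fixpoint l2_of_Rn (R : realType) (n : nat) : Rn R n -> l2 R n :=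
  match n return Rn R n -> l2 R n with
  | 0 => fun=> (0 : 'rV[R]_0)
  | m.+1 => fun u =>
    (row_mx ((u.1 : R)%:M : 'rV[R]_1) (l2_of_Rn u.2) : 'rV[R]_(1 + m))
  end.

Definition volume (R : realType) (n : nat) (A : set (l2 R n)) : \bar R :=
  lebesgue_Rn R n (@l2_of_Rn R n @^-1` A).

(* For finite dimensional X this depends only on the linear structure, all norms
   on X being equivalent. *)
Definition symmetric_convex_body (R : realType) (X : normedModType R)
    (A : set X) : Prop :=
  [/\ bounded_set A, closed A, convex_set A, A° !=set0
    & forall x, A x -> A (- x)].

Definition linear_isometry (R : realType) (X Y : normedModType R)
    (J : {linear X -> Y}) : Prop :=
  forall x, `|J x| = `|x|.

Definition continuous_projection_onto (R : realType) (Y : normedModType R)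
    (P : {linear Y -> Y}) (E : set Y) : Prop :=
  [/\ continuous P, forall y, P (P y) = P y & range P = E].

Definition unit_ball (R : realType) (Y : normedModType R) : set Y :=
  [set y | `|y| <= 1].

Definition sufficient_enlargement (R : realType) (X : normedModType R)
    (A : set X) : Prop :=
  symmetric_convex_body A /\
  forall (Y : completeNormedModType R) (J : {linear X -> Y}),
    linear_isometry J ->
    exists P : {linear Y -> Y},
      continuous_projection_onto P (range J) /\
      P @` @unit_ball R Y `<=` J @` A.

Definition minimal_volume_sufficient_enlargement (R : realType) (n : nat)
    (A : set (l2 R n)) : Prop :=
  sufficient_enlargement A /\
  forall B : set (l2 R n), sufficient_enlargement B ->
    (volume A <= volume B)%E.

(* n orthonormal vectors of R^n automatically form a basis. *)
Definition orthonormal_basis (R : realType) (n : nat) (w : 'I_n -> l2 R n) :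
    Prop :=
  forall i j, dot (w i) (w j) = (i == j)%:R.

Definition circumscribed_cube (R : realType) (n : nat) (A : set (l2 R n)) :
    Prop :=
  exists w : 'I_n -> l2 R n,
    orthonormal_basis w /\ A = [set x | forall i, `|dot x (w i)| <= 1].

(* Main.v *)
(* Embed l_2^n into R^N by u |-> (<u, x_k>)_k, where (x_k) is a fine net of the
   ball and R^N is renormed so that the embedding is isometric while its unit
   ball still nearly contains [-1, 1]^N. The images y_k of the unit vectors under
   the projection satisfy sum_k <u, x_k> y_k = u, and the zonotope
   sum_k [-y_k, y_k] is nearly contained in the enlargement A. Its volume is
   2^n times the sum of |det(y_k, k in K)| over the n-subsets K, while
   Cauchy-Binet gives 1 = sum_K det(x_K) det(y_K) with |det x_K| <= 1 by
   Hadamard. A cube circumscribed about the ball is a sufficient enlargement (by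
   Hahn-Banach) of volume 2^n, so vol A <= 2^n and |det x_K| is nearly 1, i.e.
   x_K is nearly orthonormal, for almost all of the weight |det y_K|. Exchanging
   one index of a good K shows that almost all of the mass of (y_k) sits at those
   k for which x_k is close to plus or minus an element of one fixed near
   orthonormal frame. As the net gets finer, the frames accumulate at an
   orthonormal basis w whose cube is contained in A. That cube already has volume
   2^n, so by convexity A contains nothing else. *)

(* As the net is refined the number [N] of its points is unbounded, and the systems [x], [y] have no
   limit. Every estimate is therefore free of [N]: boundedness of [A], tested with the signs of one
   coordinate of the [y k], bounds the total mass of [y] by a constant [m] independent of the net,
   and only the frame, a point of a compact set of n by n matrices, is passed to the limit. The
   vectors [y k] return only through the expansion of [u] in them: replacing the coefficients
   [<u, x_k>] by numbers in [-1, 1] changes the sum little, so points of [A] lie arbitrarily near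
   each [u] of the limit cube, and [A] is closed. Sums run over all maps from ['I_n] to the indices
   instead of n-subsets: maps that are not injective contribute 0 and each subset is counted n!
   times, whence the factorials. Translations and shears are the only maps under which the volume is
   shown invariant. They suffice for the lower bound on zonotopes, and the limit cube, a rotated
   one, gets its volume from that same bound. *)
From HB Require Import structures.
Require Import Defs.
From mathcomp Require Import all_boot all_order all_algebra perm.
From mathcomp Require Import ring lra.
From mathcomp Require Import all_classical all_reals all_analysis measurable_realfun.

Set Implicit Arguments.
Unset Strict Implicit.
Unset Printing Implicit Defensive.

Import Order.TTheory GRing.Theory Num.Theory.
Import numFieldNormedType.Exports.

Local Open Scope classical_set_scope.
Local Open Scope ring_scope.

(** * Hadamard's inequality and the Cauchy-Binet formula *)

Section LinearAlgebra.
Variable R : realType.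

Lemma dotE n (x y : 'rV[R]_n) : dot x y = (x *m y^T) ord0 ord0.
Proof. by rewrite mxE; apply: eq_bigr => i _; rewrite mxE. Qed.

Lemma dot_sqrE n (x : 'rV[R]_n) : dot x x = \sum_i x 0 i ^+ 2.
Proof. by apply: eq_bigr => i _; rewrite expr2. Qed.

Lemma dotDr n (x y z : 'rV[R]_n) : dot x (y + z) = dot x y + dot x z.
Proof. by rewrite dotC dotDl !(dotC x). Qed.

Lemma dotZr n a (x y : 'rV[R]_n) : dot x (a *: y) = a * dot x y.
Proof. by rewrite dotC dotZl (dotC x). Qed.

Lemma dotNr n (x y : 'rV[R]_n) : dot x (- y) = - dot x y.
Proof. by rewrite -scaleN1r dotZr mulN1r. Qed.

Lemma dot_sqrD n (x y : 'rV[R]_n) :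
  dot (x + y) (x + y) = dot x x + dot x y *+ 2 + dot y y.
Proof. by rewrite dotDl !dotDr (dotC y x) mulr2n !addrA. Qed.

(** Gram-Schmidt on the first row: subtracting its projection onto the other rows is a unimodular
    operation that makes the Gram matrix block diagonal and shortens the row. If the other rows are
    dependent, the Gram determinant vanishes. *)
Lemma gram_det m n (X : 'M[R]_(m, n)) :
  0 <= \det (X *m X^T) <= \prod_i dot (row i X) (row i X).
Proof.
elim: m X => [|m IH] X; first by rewrite det_mx00 big_ord0 ler01 lexx.
rewrite -[m.+1]/(1 + m)%N in X *.
set D := dsubmx X *m (dsubmx X)^T.
have prodE : \prod_i dot (row i X) (row i X) =
    dot (usubmx X) (usubmx X) * \prod_i dot (row i (dsubmx X)) (row i (dsubmx X)).
  rewrite big_ord_recl; congr (dot _ _ * _).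
  - by apply/rowP => j; rewrite !mxE; congr (X _ _); apply/val_inj.
  - by apply/rowP => j; rewrite !mxE; congr (X _ _); apply/val_inj.
  apply: eq_bigr => i _; congr dot; apply/rowP => j; rewrite !mxE;
    by congr (X _ _); apply/val_inj.
have /andP[D0 Dle] := IH (dsubmx X).
rewrite prodE.
have [Dsing|Dreg] := boolP (D \in unitmx); last first.
  have [v v0 vD] : exists2 v : 'rV[R]_m, v != 0 & v *m D = 0.
    move: Dreg; rewrite -row_free_unit -kermx_eq0 => /rowV0Pn[v /sub_kermxP vD v0].
    by exists v.
  have vX : v *m dsubmx X = 0.
    apply: dot_eq0; rewrite dotE trmx_mul mulmxA -(mulmxA v) -/D vD.
    by rewrite mul0mx mxE.
  have XX0 : row_mx 0 v *m (X *m X^T) = 0 :> 'rV[R]_(1 + m).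
    by rewrite mulmxA -{1}[X]vsubmxK mul_row_col mul0mx add0r vX mul0mx.
  have -> : \det (X *m X^T) = 0.
    apply/eqP/det0P; exists (row_mx 0 v) => //.
    by apply: contra v0 => /eqP; rewrite -row_mx0 => /eq_row_mx[_ ->].
  rewrite lexx mulr_ge0 ?dot_ge0//; apply: prodr_ge0 => i _; exact: dot_ge0.
(* Coefficients of the orthogonal projection of the first row onto the span of the others. *)
pose c := usubmx X *m (dsubmx X)^T *m invmx D.
pose x' := usubmx X - c *m dsubmx X.
have x'X : x' *m (dsubmx X)^T = 0.
  by rewrite mulmxBl -(mulmxA c) -/D /c mulmxKV// subrr.
pose L := block_mx 1%:M (- c) 0 1%:M : 'M[R]_(1 + m).
have detL : \det L = 1 by rewrite det_ublock !det1 mulr1.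
have LX : L *m X = col_mx x' (dsubmx X).
  rewrite -{1}[X]vsubmxK mul_block_col !mul1mx mul0mx add0r.
  by rewrite mulNmx.
have -> : \det (X *m X^T) = dot x' x' * \det D.
  transitivity (\det ((L *m X) *m (L *m X)^T)).
    have -> : (L *m X) *m (L *m X)^T = L *m (X *m X^T) *m L^T.
      by rewrite trmx_mul !mulmxA.
    by rewrite !(det_mulmx _ L^T, det_mulmx L) det_tr detL mul1r mulr1.
  rewrite LX tr_col_mx mul_col_row x'X det_lblock; congr (_ * _).
  by rewrite dotE det_mx11.
have x'le : dot x' x' <= dot (usubmx X) (usubmx X).
  have uE : usubmx X = x' + c *m dsubmx X by rewrite subrK.
  have o : dot x' (c *m dsubmx X) = 0.
    by rewrite dotE trmx_mul mulmxA x'X mul0mx mxE.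
  by rewrite uE dot_sqrD o mul0rn addr0 lerDl dot_ge0.
by rewrite mulr_ge0 ?dot_ge0//= ler_pM ?dot_ge0.
Qed.

Lemma det_sqr_le n (f : 'I_n -> 'rV[R]_n) :
  (\det (\matrix_i f i)) ^+ 2 <= \prod_i dot (f i) (f i).
Proof.
have /andP[_] := gram_det (\matrix_i f i).
rewrite det_mulmx det_tr -expr2 => /le_trans; apply.
by under eq_bigr do rewrite rowK.
Qed.

Lemma det_le1 n (f : 'I_n -> 'rV[R]_n) :
  (forall i, dot (f i) (f i) <= 1) -> `|\det (\matrix_i f i)| <= 1.
Proof.
move=> f1; rewrite -(@ler_pXn2r _ 2) ?nnegrE// expr1n real_normK ?num_real//.
apply: le_trans (det_sqr_le f) _.
by apply: prodr_ile1 => i _; rewrite dot_ge0 f1.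
Qed.

(* Removing from [f a] its component along [f b] keeps the determinant and
   shortens [f a], so in the equality case of Hadamard's inequality there is no
   such component. *)
Lemma det_ge1_orthonormal n (f : 'I_n -> 'rV[R]_n) :
    (forall i, dot (f i) (f i) <= 1) -> 1 <= `|\det (\matrix_i f i)| ->
  orthonormal_basis f.
Proof.
move=> f1 d1.
have prod1 (g : 'I_n -> 'rV[R]_n) a : (forall i, dot (g i) (g i) <= 1) ->
    1 <= `|\det (\matrix_i g i)| -> dot (g a) (g a) = 1.
  move=> g1 dg; apply/eqP; rewrite eq_le g1/=.
  have := det_sqr_le g; rewrite (bigD1 a)//= -real_normK ?num_real// => h.
  apply: (le_trans (le_trans _ h)); first by rewrite -[leLHS](expr1n _ 2) ler_pXn2r ?nnegrE.
  rewrite ler_piMr ?dot_ge0//.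
  by apply: prodr_ile1 => i _; rewrite dot_ge0 g1.
move=> a b; have [->|ab] := eqVneq a b; first exact: (prod1 f).
apply/eqP; set c := dot (f a) (f b).
pose g i := if i == a then f a - c *: f b else f i.
have dga : dot (g a) (g a) = 1 - c ^+ 2.
  rewrite /g eqxx -scaleNr dot_sqrD !(dotZr, dotZl) -/c !prod1//.
  by rewrite expr2 mulr2n; ring.
have g1 i : dot (g i) (g i) <= 1.
  have [->|ia] := eqVneq i a; first by rewrite dga gerBl sqr_ge0.
  by rewrite /g (negbTE ia).
have detg : \det (\matrix_i g i) = \det (\matrix_i f i).
  pose B := \matrix_i (if i == a then f b else f i).
  have B0 : \det B = 0.
    apply: (determinant_alternate ab) => j.
    by rewrite !mxE eqxx; case: eqP.
  rewrite (@determinant_multilinear _ _ (\matrix_i g i) (\matrix_i f i) B a 1 (- c)).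
  - by rewrite B0 mulr0 addr0 mul1r.
  - by rewrite !rowK /g eqxx scale1r scaleNr.
  - apply/matrixP => i j; rewrite !mxE /g.
    by rewrite eq_sym (negbTE (neq_lift _ _)).
  - apply/matrixP => i j; rewrite !mxE /g.
    by rewrite eq_sym (negbTE (neq_lift _ _)).
have := prod1 g a g1; rewrite detg dga => /(_ d1) /eqP.
by rewrite -subr_eq0 addrAC subrr add0r oppr_eq0 sqrf_eq0.
Qed.

(** Expand the determinant of the [x] rows over permutations. Reindexing [f] by the permutation [s]
    cancels its sign against that of the [y] determinant, so all n! contributions [S s] agree. *)
Lemma cauchy_binet (I : finType) n (x y : I -> 'rV[R]_n) :
  \sum_(f : {ffun 'I_n -> I})
     \det (\matrix_i x (f i)) * \det (\matrix_i y (f i)) =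
  n`!%:R * \det (\sum_k (x k)^T *m y k).
Proof.
pose S (s : 'S_n) := \sum_(f : {ffun 'I_n -> I})
  (\prod_i x (f (s i)) 0 i) * ((-1) ^+ s * \det (\matrix_i y (f i))).
have SE s : S s = \det (\sum_k (x k)^T *m y k).
  transitivity (\sum_(f : {ffun 'I_n -> I})
      (\prod_i x (f i) 0 i) * \det (\matrix_i y (f i))).
    pose h (f : {ffun 'I_n -> I}) := [ffun i => f ((s^-1)%g i)] : {ffun 'I_n -> I}.
    rewrite /S (reindex_inj (h := h)) /=; last first.
      move=> f g /ffunP fg; apply/ffunP => i.
      by have := fg (s i); rewrite !ffunE permK.
    apply: eq_bigr => f _; congr (_ * _).
      by apply: eq_bigr => i _; rewrite ffunE permK.
    have -> : (\matrix_i y (h f i)) = row_perm (s^-1)%g (\matrix_i y (f i)).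
      by apply/matrixP => i j; rewrite !mxE ffunE.
    rewrite row_permE det_mulmx det_perm mulrA odd_permV -signr_addb addbb.
    by rewrite mul1r.
  rewrite [RHS]/determinant.
  under [RHS]eq_bigr => t _.
    under eq_bigr => i _.
      rewrite summxE; under eq_bigr do rewrite mxE big_ord1 mxE.
      over.
    rewrite bigA_distr_bigA mulr_sumr /=.
    over.
  rewrite exchange_big /=; apply: eq_bigr => f _.
  rewrite /determinant mulr_sumr; apply: eq_bigr => t _.
  rewrite big_split/= mulrCA; congr (_ * (_ * _)).
  by apply: eq_bigr => i _; rewrite mxE.
transitivity (\sum_s S s); last first.
  under eq_bigr do rewrite SE.
  by rewrite sumr_const card_Sn mulr_natl.
rewrite exchange_big/=; apply: eq_bigr => f _.
rewrite -det_tr [X in X * _]/determinant mulr_suml; apply: eq_bigr => s _.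
rewrite mulrCA mulrA; congr (_ * _ * _).
by apply: eq_bigr => i _; rewrite !mxE.
Qed.

End LinearAlgebra.

(** * Invariance of the volume under translations and shears *)

Section Volume.
Variable R : realType.
Implicit Types n m : nat.

Lemma rV_continuous (T : topologicalType) n (f : T -> 'rV[R]_n) :
  (forall i, continuous (fun t => f t 0 i)) -> continuous f.
Proof.
move=> fc x; apply/cvg_ballP => e e0.
have : \forall y \near x, forall i, ball (f x 0 i) e (f y 0 i).
  by apply: filter_forall => i; exact: (cvg_ball (fc i x)).
apply: filterS => y xy; split=> // i j; rewrite (ord1 i); exact: xy.
Qed.

Lemma sum_continuous (T : topologicalType) (V : normedModType R) (I : Type)
    (r : seq I) (P : pred I) (f : I -> T -> V) :
  (forall i, P i -> continuous (f i)) ->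
  continuous (fun t => \sum_(i <- r | P i) f i t).
Proof. by move=> fc; apply: continuous_big => //; exact: add_continuous. Qed.

Lemma mulmxr_continuous n m (T : 'M[R]_(n, m)) :
  continuous (fun x : 'rV[R]_n => x *m T).
Proof.
apply: rV_continuous => j; under [X in continuous X]funext do rewrite mxE.
apply: sum_continuous => k _ x.
have h := @coord_continuous R 1 n 0 k x; exact: cvgMl h.
Qed.

Definition cons_rV n (t : R) (x : 'rV[R]_n) : 'rV[R]_(1 + n) := row_mx t%:M x.

Lemma cons_rV0 n t (x : 'rV[R]_n) : cons_rV t x 0 0 = t.
Proof.
have -> : 0 = lshift n 0 :> 'I_(1 + n) by apply/val_inj.
by rewrite row_mxEl mxE mulr1n.
Qed.

Lemma cons_rVS n t (x : 'rV[R]_n) i : cons_rV t x 0 (lift 0 i) = x 0 i.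
Proof.
have -> : lift 0 i = rshift 1 i by apply/val_inj.
by rewrite row_mxEr.
Qed.

Lemma cons_rVP n (x : 'rV[R]_(1 + n)) : exists t x', x = cons_rV t x'.
Proof.
exists (x 0 0), (rsubmx x); apply/rowP => i; case: (unliftP 0 i) => [j|] ->.
  by rewrite cons_rVS mxE; congr (x _ _); apply/val_inj.
by rewrite cons_rV0.
Qed.

Lemma cons_rV_continuousl n (x : 'rV[R]_n) : continuous (fun t => cons_rV t x).
Proof.
apply: rV_continuous => i; case: (unliftP 0 i) => [j|] ->.
  under [X in continuous X]funext do rewrite cons_rVS; exact: cst_continuous.
under [X in continuous X]funext do rewrite cons_rV0.
by move=> t; exact: cvg_id.
Qed.

Lemma cons_rV_continuousr n t : continuous (fun x : 'rV[R]_n => cons_rV t x).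
Proof.
apply: rV_continuous => i; case: (unliftP 0 i) => [j|] ->.
  by under [X in continuous X]funext do rewrite cons_rVS; exact: coord_continuous.
by under [X in continuous X]funext do rewrite cons_rV0; exact: cst_continuous.
Qed.

Lemma l2_of_RnS n (u : Rn R n.+1) :
  l2_of_Rn u = cons_rV u.1 (l2_of_Rn u.2).
Proof. by []. Qed.

Lemma measurable_coord n (i : 'I_n) :
  measurable_fun setT (fun u : Rn R n => l2_of_Rn u 0 i : measurableTypeR R).
Proof.
elim: n i => [[]//|n IH] i.
case: (unliftP 0 i) => [j|] ->.
  rewrite (_ : (fun u => _) = (fun u : Rn R n.+1 => l2_of_Rn u.2 0 j)).
    exact: (measurableT_comp (IH j) measurable_snd).
  by apply/funext => u; rewrite l2_of_RnS cons_rVS.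
rewrite (_ : (fun u => _) = (fun u : Rn R n.+1 => u.1)).
  exact: measurable_fst.
by apply/funext => u; rewrite l2_of_RnS cons_rV0.
Qed.

(** A countable base of the topology: open sets become countable unions of sets cut out by
    coordinates, hence measurable for the product structure of [Rn]. *)
Definition box n (q : 'rV[rat]_n) (k : nat) : set 'rV[R]_n :=
  [set x | forall i, `|x 0 i - ratr (q 0 i)| < k.+1%:R^-1].

Lemma measurable_box n q k : measurable (@l2_of_Rn R n @^-1` box q k).
Proof.
rewrite (_ : _ @^-1` _ = \bigcap_(i in [set: 'I_n])
  ((fun u => l2_of_Rn u 0 i) @^-1` (ball (ratr (q 0 i) : R) k.+1%:R^-1))); last first.
  apply/seteqP; split => u /=.
    by move=> h i _; rewrite /= -ball_normE /= distrC; apply: h.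
  by move=> h i; have := h i I; rewrite /= -ball_normE /= distrC; apply.
apply: fin_bigcap_measurable => // i _.
rewrite -[X in measurable X]setTI; apply: measurable_coord => //.
by apply: open_measurable; exact: ball_open.
Qed.

Lemma open_box n (U : set 'rV[R]_n) x : open U -> U x ->
  exists q k, box q k x /\ box q k `<=` U.
Proof.
move=> oU Ux; have /nbhs_ballP[e e0 eU] := open_nbhs_nbhs (conj oU Ux).
have [k _ ke] := near_infty_natSinv_lt (PosNum (divr_gt0 e0 (@ltr0n R 2))).
have {}ke := ke k (leqnn k).
have k0 : 0 < k.+1%:R^-1 :> R by rewrite invr_gt0.
have qe i : {q : rat | `|x 0 i - ratr q| < k.+1%:R^-1}.
  apply/cid; move: k0; set d := k.+1%:R^-1 => d0.
  have [|q] := @rat_in_itvoo R (x 0 i - d) (x 0 i + d).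
    by rewrite ltrBlDr -addrA ltrDl addr_gt0.
  by rewrite in_itv/= => qd; exists q; rewrite distrC ltr_distl.
exists (\row_i sval (qe i)), k; split=> [i|y yq]; first by rewrite mxE; case: (qe i).
apply: eU; split=> // i j; rewrite ord1 -ball_normE /=.
have := yq j; rewrite mxE; case: (qe j) => q /= xq yq'.
rewrite (splitr e) -(subrK (ratr q) (x 0 j)) -addrA.
apply: le_lt_trans (ler_normD _ _) _; rewrite ltrD//.
  exact: lt_trans ke.
by rewrite distrC; apply: lt_trans ke.
Qed.

Lemma measurable_open n (U : set 'rV[R]_n) : open U ->
  measurable (@l2_of_Rn R n @^-1` U).
Proof.
move=> oU.
rewrite (_ : U = \bigcup_(p : 'rV[rat]_n * nat)
   (if pselect (box p.1 p.2 `<=` U) then box p.1 p.2 else set0)); last first.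
  apply/seteqP; split=> x.
    by move=> /(open_box oU)[q [k [xq qU]]]; exists (q, k) => //=; case: pselect.
  by move=> [p _] /=; case: pselect => /= pU; [exact: pU|].
rewrite preimage_bigcup; apply: countable_bigcupT_measurable.
  exact: countableP.
move=> p; case: (pselect _) => pU; first exact: measurable_box.
by rewrite preimage_set0.
Qed.

Lemma measurable_closed n (A : set 'rV[R]_n) : closed A ->
  measurable (@l2_of_Rn R n @^-1` A).
Proof.
move=> cA; rewrite -[A]setCK -[X in measurable X]preimage_setC; apply: measurableC; apply: measurable_open.
exact: closed_openC.
Qed.

Lemma volume_xsection n (A : set 'rV[R]_(1 + n)) :
  volume (n := n.+1) A = (\int[lebesgue_measure]_t volume (n := n) [set x | A (cons_rV t x)])%E.
Proof.
rewrite /volume/= /sigma_finite_product /product_measure1.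
apply: eq_integral => t _ /=; congr (lebesgue_Rn R n _).
by apply/seteqP; split=> u; rewrite /xsection /= inE.
Qed.

(** Fubini in the order that is not built into [volume]. Uniqueness of the product measure is
    applied to a measurable set, whence the closedness. *)
Lemma volume_ysection n (A : set 'rV[R]_(1 + n)) : closed A ->
  volume (n := n.+1) A =
  (\int[lebesgue_Rn R n]_u lebesgue_measure [set t : R | A (cons_rV t (l2_of_Rn u))])%E.
Proof.
move=> cA; rewrite /volume/= /sigma_finite_product.
rewrite (@product_measure_unique _ _ _ _ _ _ _
   (product_measure2 lebesgue_measure (lebesgue_Rn R n))).
- rewrite /product_measure2; apply: eq_integral => u _ /=; congr lebesgue_measure.
  by apply/seteqP; split=> t; rewrite /ysection /= inE.
- by move=> B C mB mC; exact: product_measure2E.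
- exact: (@measurable_closed n.+1).
Qed.

Lemma lebesgue_measure_translation (B : set (measurableTypeR R)) (a : R) : measurable B ->
  lebesgue_measure [set t : R | B (t + a)] = lebesgue_measure B.
Proof.
move=> mB; have mf : measurable_fun setT (fun t : measurableTypeR R => t + a : measurableTypeR R).
  exact: measurable_funD.
pose mu := measure_function_pushforward__canonical__measure_function_Measure
  (@lebesgue_measure R) mf.
apply/esym; rewrite (@lebesgue_measure_unique _ mu)// => X [[x y] _ <-].
rewrite /mu /= /pushforward.
rewrite (_ : _ @^-1` _ = `]x - a, y - a]%classic).
  rewrite !lebesgue_measure_itv /= !lte_fin ltrD2r; case: ifP => // _.
  by rewrite -!EFinB opprB addrA subrK.
by apply/seteqP; split=> t; rewrite /= !in_itv/= ltrBlDr lerBrDr.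
Qed.

Lemma preimage_closedT (T U : topologicalType) (f : T -> U) (A : set U) :
  continuous f -> closed A -> closed [set x | A (f x)].
Proof. by move=> /continuous_closedP; exact. Qed.

Lemma cons_rVD n a b (x y : 'rV[R]_n) :
  cons_rV a x + cons_rV b y = cons_rV (a + b) (x + y).
Proof. by rewrite /cons_rV add_row_mx -raddfD. Qed.

Lemma cons_rVZ n a t (x : 'rV[R]_n) : a *: cons_rV t x = cons_rV (a * t) (a *: x).
Proof. by rewrite /cons_rV scale_row_mx scale_scalar_mx. Qed.

Lemma closed_measurable_slice n (A : set 'rV[R]_(1 + n)) x : closed A ->
  measurable ([set t | A (cons_rV t x)] : set (measurableTypeR R)).
Proof.
move=> cA; apply: closed_measurable; apply: preimage_closedT cA.
exact: cons_rV_continuousl.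
Qed.

Lemma volume_ext n (A B : set 'rV[R]_n) : A = B -> volume (n := n) A = volume (n := n) B.
Proof. by move->. Qed.

(** Each line parallel to the first axis is translated by an amount that depends on the line, so
    lengths of slices are kept. Closedness of the moved set stands in for regularity of [f]. *)
Lemma volume_shift0 n (A : set 'rV[R]_(1 + n)) (f : 'rV[R]_n -> R) : closed A ->
    closed [set x : 'rV[R]_(1 + n) | A (x + cons_rV (f (rsubmx x)) 0)] ->
  volume (n := n.+1) [set x : 'rV[R]_(1 + n) | A (x + cons_rV (f (rsubmx x)) 0)] =
  volume (n := n.+1) A.
Proof.
move=> cA cA'; rewrite !volume_ysection//; apply: eq_integral => u _ /=.
under [X in lebesgue_measure X]eq_set do
  rewrite cons_rVD addr0 row_mxKr.
rewrite (@lebesgue_measure_translation [set t | A (cons_rV t (l2_of_Rn u))])//.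
exact: closed_measurable_slice.
Qed.

(** By induction on the dimension: [volume_shift0] absorbs the first coordinate of [v], the slices
    at fixed first coordinate absorb the rest. *)
Lemma volume_translation n (A : set 'rV[R]_n) v : closed A ->
  volume (n := n) [set x | A (x + v)] = volume (n := n) A.
Proof.
elim: n A v => [|n IH] A v cA.
  by apply: volume_ext; apply/seteqP; split => x /=; rewrite [x + v]thinmx0 [x]thinmx0.
have [a [v' ->]] := @cons_rVP n v.
have cc (w : 'rV[R]_(1 + n)) : continuous (fun x : 'rV[R]_(1 + n) => x + w).
  move=> x; exact: (@cvgD R _ _ _ _ _ _ _ _ (@cvg_id _ (nbhs x)) (@cvg_cst _ w _ (nbhs x) _)).
rewrite -[RHS](@volume_shift0 n A (fun=> a))//; last exact: preimage_closedT.
rewrite !(@volume_xsection n); apply: eq_integral => t _ /=.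
rewrite -[LHS](IH _ (- v')); last first.
  exact: (preimage_closedT (@cons_rV_continuousr n t) (preimage_closedT (cc _) cA)).
by apply: volume_ext; apply/seteqP; split => x /=; rewrite !cons_rVD addr0 ?subrK.
Qed.

(** The two kinds of shear for which Fubini reduces invariance to translations: [shear_col]
    translates each line along the first axis, [shear_row] each slice at fixed first coordinate. *)
Definition shear_col n (a : 'rV[R]_n) : 'M[R]_(1 + n) := block_mx 1%:M 0 a^T 1%:M.
Definition shear_row n (v : 'rV[R]_n) : 'M[R]_(1 + n) := block_mx 1%:M v 0 1%:M.

Lemma mul_shear_col n t (x a : 'rV[R]_n) :
  cons_rV t x *m shear_col a = cons_rV (t + dot x a) x.
Proof.
rewrite /cons_rV mul_row_block !mulmx1 mulmx0 add0r; congr row_mx.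
by apply/rowP => j; rewrite ord1 !mxE dotE !mxE mulr1n.
Qed.

Lemma mul_shear_row n t (x v : 'rV[R]_n) :
  cons_rV t x *m shear_row v = cons_rV t (t *: v + x).
Proof. by rewrite /cons_rV mul_row_block !mulmx1 mulmx0 addr0 mul_scalar_mx. Qed.

Lemma volume_shear_col n (a : 'rV[R]_n) (A : set 'rV[R]_(1 + n)) : closed A ->
  volume (n := n.+1) [set x | A (x *m shear_col a)] = volume (n := n.+1) A.
Proof.
move=> cA; rewrite -[RHS](@volume_shift0 _ _ (fun x => dot x a))//.
  apply: (@volume_ext n.+1); apply/seteqP; split=> x /=;
  by have [t [x' ->]] := cons_rVP x; rewrite mul_shear_col cons_rVD addr0 row_mxKr.
rewrite (_ : [set x | _] = [set x | A (x *m shear_col a)]).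
  by apply: preimage_closedT cA; exact: mulmxr_continuous.
apply/seteqP; split=> x /=;
by have [t [x' ->]] := cons_rVP x; rewrite mul_shear_col cons_rVD addr0 row_mxKr.
Qed.

Lemma volume_shear_row n (v : 'rV[R]_n) (A : set 'rV[R]_(1 + n)) : closed A ->
  volume (n := n.+1) [set x | A (x *m shear_row v)] = volume (n := n.+1) A.
Proof.
move=> cA; rewrite !volume_xsection; apply: eq_integral => t _ /=.
rewrite -[RHS](@volume_translation n [set x | A (cons_rV t x)] (t *: v)).
  apply: volume_ext; apply/seteqP; split => x /=;
  by rewrite mul_shear_row addrC.
by apply: preimage_closedT cA; exact: cons_rV_continuousr.
Qed.

Lemma det_shear_col n (a : 'rV[R]_n) : \det (shear_col a) = 1.
Proof. by rewrite det_lblock !det1 mulr1. Qed.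

Lemma det_shear_row n (a : 'rV[R]_n) : \det (shear_row a) = 1.
Proof. by rewrite det_ublock !det1 mulr1. Qed.

(* Two shears send [y] to a multiple of the first unit vector, so that adding the
   segment [-y, y] lengthens each slice along the first coordinate. *)
Lemma exists_shear n (y : 'rV[R]_(1 + n)) : y != 0 ->
  exists T : 'M[R]_(1 + n), [/\ \det T = 1,
    forall A, closed A -> volume (n := n.+1) [set x | A (x *m T)] = volume (n := n.+1) A
    & exists2 c, c != 0 & y *m T = cons_rV c 0].
Proof.
have [t [x ->]] := cons_rVP y => y0.
have [a ta] : exists a, t + dot x a != 0.
  have [t0|t0] := eqVneq t 0; last by exists 0; rewrite dotE trmx0 mulmx0 mxE addr0.
  exists x; rewrite t0 add0r; apply: contra y0 => /eqP/dot_eq0 ->.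
  by rewrite t0 /cons_rV raddf0 row_mx0.
set c := t + dot x a in ta.
exists (shear_col a *m shear_row (- c^-1 *: x)); split.
- by rewrite det_mulmx det_shear_col det_shear_row mulr1.
- move=> A cA; rewrite -[RHS](volume_shear_row (- c^-1 *: x))// -[RHS](volume_shear_col a).
    by apply: (@volume_ext n.+1); apply/seteqP; split => z /=; rewrite mulmxA.
  by apply: preimage_closedT cA; exact: mulmxr_continuous.
- exists c => //.
  by rewrite mulmxA mul_shear_col mul_shear_row scalerA mulrN divff// scaleN1r addNr.
Qed.

(** The one-dimensional case of adding a segment: [s] is an interval [a, b], and [S] contains
    [a - |c|, b + |c|]. *)
Lemma interval_expand (s S : set (measurableTypeR R)) (c : R) :
    compact (s : set R) -> s !=set0 ->
    (forall a b p, s a -> s b -> a <= p <= b -> s p) -> measurable S ->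
    (forall q r, `|r| <= `|c| -> s q -> S (q + r)) ->
  (lebesgue_measure s + (`|c| *+ 2)%:E <= lebesgue_measure S)%E.
Proof.
move=> cs s0 conv mS sS.
have idc : {within s, continuous (fun x : R => x)}.
  by apply: continuous_subspaceT => x; exact: cvg_id.
have [a sa ma] : exists2 a : R, s a & forall t : R, s t -> a <= t.
  have [a] := compact_EVT_min s0 cs idc; rewrite inE => sa ma.
  by exists a => // t st; apply: ma; rewrite inE.
have [b sb mb] : exists2 b : R, s b & forall t : R, s t -> t <= b.
  have [b] := compact_EVT_max s0 cs idc; rewrite inE => sb mb.
  by exists b => // t st; apply: mb; rewrite inE.
have ab : a <= b by exact: ma.
have c0 : 0 <= `|c| by [].
have sE : (s : set R) = `[a, b]%classic.
  apply/seteqP; split=> x /=; rewrite in_itv/=.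
    by move=> sx; rewrite ma ?mb.
  by move=> abx; exact: conv sa sb abx.
have SE : `[a - `|c|, b + `|c|]%classic `<=` (S : set R).
  move=> p /=; rewrite in_itv/= => /andP[ap pb].
  have [pa|ap'] := ltP p a.
    rewrite -(subrK a p) addrC; apply: sS => //.
    by rewrite ler_norml; lra.
  have [bp|pb'] := ltP b p.
    rewrite -(subrK b p) addrC; apply: sS => //.
    by rewrite ler_norml; lra.
  by rewrite -(addr0 p); apply: sS; rewrite ?normr0//; apply: conv sa sb _; rewrite ap'.
apply: (@le_trans _ _ (lebesgue_measure (`[a - `|c|, b + `|c|]%classic : set R))); last first.
  by apply: le_measure; rewrite ?inE.
rewrite sE !lebesgue_measure_itv/= !lte_fin.
have -> : (if (a < b)%R then b%:E - a%:E else 0)%E = (b - a)%:E.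
  by case: ltgtP ab => // -> _; rewrite subrr.
have [h|h] := ltP (a - `|c|) (b + `|c|); first by rewrite -EFinB -EFinD lee_fin; lra.
by rewrite -EFinD lee_fin; lra.
Qed.

End Volume.

(** * Volume of zonotopes *)

Section Zonotope.
Variable R : realType.
Implicit Types n m : nat.

Lemma rV_hausdorff n : hausdorff_space 'rV[R]_n.
Proof. exact: norm_hausdorff. Qed.

Lemma measurable_slice n (A : set 'rV[R]_(1 + n)) : closed A ->
  measurable_fun setT (fun u : Rn R n =>
    @lebesgue_measure R [set t | A (cons_rV t (l2_of_Rn u))]).
Proof.
move=> cA.
have := measurable_fun_ysection (@lebesgue_measure R) (@measurable_closed R n.+1 _ cA).
congr (measurable_fun _ _); apply/funext => u /=; congr lebesgue_measure.
by apply/seteqP; split=> t; rewrite /ysection /= inE.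
Qed.

(** Integrate [interval_expand] over the lines along the first axis: those over [C] meet [B] and
    gain at least 2|c|, the others lose nothing. *)
Lemma volume_slab n (B B' : set 'rV[R]_(1 + n)) (C : set 'rV[R]_n) (c : R) :
    compact B -> closed B' -> closed C ->
    (forall x, C x -> exists t, B (cons_rV t x)) ->
    (forall (t t' s : R) x, B (cons_rV t x) -> B (cons_rV t' x) -> t <= s <= t' ->
       B (cons_rV s x)) ->
    (forall (t s : R) x, `|s| <= `|c| -> B (cons_rV t x) -> B' (cons_rV (t + s) x)) ->
  (volume (n := n.+1) B + (`|c| *+ 2)%:E * volume (n := n) C <=
   volume (n := n.+1) B')%E.
Proof.
move=> kB cB' cC CB convB BB'.
have cB : closed B by apply: compact_closed kB; exact: rV_hausdorff.
have mC : measurable (@l2_of_Rn R n @^-1` C) by exact: measurable_closed.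
rewrite !volume_ysection//.
have -> : volume (n := n) C =
    (\int[lebesgue_Rn R n]_u (\1_(@l2_of_Rn R n @^-1` C) u)%:E)%E.
  by rewrite integral_indic// setIT.
have m1 : measurable_fun setT (fun u => (\1_(@l2_of_Rn R n @^-1` C) u)%:E : \bar R).
  by apply/measurable_EFinP; exact: measurable_indic.
have c0 : 0 <= `|c| *+ 2 by rewrite mulrn_wge0.
rewrite -ge0_integralZl_EFin//.
have mB := measurable_slice cB; have mB' := measurable_slice cB'.
have m2 := measurable_funeM (`|c| *+ 2)%:E m1.
rewrite -ge0_integralD//.
apply: ge0_le_integral => //.
  by move=> u _; rewrite adde_ge0// mule_ge0.
  exact: emeasurable_funD.
move=> u _ /=; set x := l2_of_Rn u.
rewrite indicE; case: (boolP (u \in _)) => [|_]; last first.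
  rewrite mule0 adde0; apply: le_measure; rewrite ?inE.
  - exact: closed_measurable_slice.
  - exact: closed_measurable_slice.
  - by move=> t /= Bt; rewrite -[t]addr0; apply: BB'; rewrite ?normr0.
rewrite inE => /= Cx; rewrite mule1; apply: interval_expand.
(* A slice of [B] is compact: it is closed, and bounded because the first coordinate is bounded on
   [B]. *)
- have [M [_ MB]] : bounded_set ((fun x : 'rV[R]_(1 + n) => x 0 0) @` B).
    apply: compact_bounded; apply: continuous_compact kB.
    by apply: continuous_subspaceT; exact: coord_continuous.
  apply: (@subclosed_compact _ _ `[- (M + 1), M + 1]%classic).
  + by apply: preimage_closedT cB; exact: cons_rV_continuousl.
  + exact: segment_compact.
  + move=> t /= Bt; rewrite in_itv/= -ler_norml.
    by apply: MB; [rewrite ltrDl|exists (cons_rV t x) => //; rewrite cons_rV0].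
- exact: CB.
- by move=> a b p /= Ba Bb abp; exact: convB Ba Bb abp.
- exact: closed_measurable_slice.
- by move=> q r rc /= Bq; exact: BB'.
Qed.

(** The set [D] of segments in use is a parameter so that they can be added one at a time. *)
Definition zonotope n (I : finType) (y : I -> 'rV[R]_n) (D : {set I}) : set 'rV[R]_n :=
  [set x | exists2 t : I -> R, (forall k, `|t k| <= 1) & x = \sum_(k in D) t k *: y k].

Lemma zonotope_mulmx n m (I : finType) (y : I -> 'rV[R]_n) (D : {set I})
    (T : 'M[R]_(n, m)) :
  zonotope (fun k => y k *m T) D = [set x *m T | x in zonotope y D].
Proof.
have E (t : I -> R) : \sum_(k in D) t k *: (y k *m T) = (\sum_(k in D) t k *: y k) *m T.
  by rewrite mulmx_suml; apply: eq_bigr => k _; rewrite scalemxAl.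
apply/seteqP; split=> [_ [t t1 ->]|_ [_ [t t1 ->] <-]].
  by rewrite E; exists (\sum_(k in D) t k *: y k) => //; exists t.
by exists t; rewrite ?E.
Qed.

Lemma zonotope_compact n (I : finType) (y : I -> 'rV[R]_n) (D : {set I}) :
  compact (zonotope y D).
Proof.
pose f (t : 'rV[R]_#|I|) : 'rV[R]_n := \sum_(k in D) t 0 (enum_rank k) *: y k.
have -> : zonotope y D = f @` [set t : 'rV[R]_#|I| | forall i, (`[-1, 1]%classic : set R) (t ord0 i)].
  apply/seteqP; split=> [_ [t t1 ->]|_ [t t1 <-]].
    exists (\row_i t (enum_val i)).
      by move=> i /=; rewrite mxE in_itv/= -ler_norml.
    by apply: eq_bigr => k _; rewrite mxE enum_rankK.
  exists (fun k => t 0 (enum_rank k)) => // k.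
  by have := t1 (enum_rank k); rewrite /= in_itv/= -ler_norml.
apply: continuous_compact.
  apply: continuous_subspaceT; apply: sum_continuous => k _ t.
  have h := @coord_continuous R 1 #|I| 0 (enum_rank k) t; exact: cvgZl h.
by apply: (@rV_compact R #|I| (fun=> `[-1, 1]%classic)) => i; exact: segment_compact.
Qed.

Lemma zonotope_closed n (I : finType) (y : I -> 'rV[R]_n) (D : {set I}) :
  closed (zonotope y D).
Proof.
by apply: compact_closed; [exact: rV_hausdorff|exact: zonotope_compact].
Qed.

Lemma zonotope_convex n (I : finType) (y : I -> 'rV[R]_n) (D : {set I}) x z p :
  zonotope y D x -> zonotope y D z -> 0 <= p <= 1 ->
  zonotope y D (p *: x + (1 - p) *: z).
Proof.
move=> [t t1 ->] [s s1 ->] /andP[p0 p1].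
exists (fun k => p * t k + (1 - p) * s k) => [k|].
  rewrite (le_trans (ler_normD _ _))// !normrM (ger0_norm p0).
  rewrite (ger0_norm (x := 1 - p)) ?subr_ge0//.
  apply: (@le_trans _ _ (p * 1 + (1 - p) * 1)); last by rewrite !mulr1 addrC subrK.
  by rewrite lerD// ler_wpM2l ?subr_ge0.
rewrite !scaler_sumr -big_split /=; apply: eq_bigr => k _.
by rewrite [RHS]scalerDl !scalerA.
Qed.

Lemma zonotope_shift n (I : finType) (y : I -> 'rV[R]_n) (D : {set I}) k r x :
  k \notin D -> `|r| <= 1 -> zonotope y D x -> zonotope y (k |: D) (x + r *: y k).
Proof.
move=> kD r1 [t t1 ->]; exists (fun j => if j == k then r else t j) => [j|].
  by case: eqP.
rewrite big_setU1//= eqxx addrC; congr (_ + _); apply: eq_bigr => j jD.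
by case: eqP => // jk; rewrite -jk jD in kD.
Qed.

Lemma sum_cons_rV n (I : finType) (D : {set I}) (t a : I -> R) (x : I -> 'rV[R]_n) :
  \sum_(k in D) t k *: cons_rV (a k) (x k) =
  cons_rV (\sum_(k in D) t k * a k) (\sum_(k in D) t k *: x k).
Proof.
apply/rowP => i; rewrite summxE; case: (unliftP 0 i) => [j|] ->.
  by rewrite cons_rVS summxE; apply: eq_bigr => k _; rewrite mxE cons_rVS mxE.
by rewrite cons_rV0; apply: eq_bigr => k _; rewrite mxE cons_rV0.
Qed.

Lemma cons_rV_hd_tl n (x : 'rV[R]_(1 + n)) : x = cons_rV (x 0 0) (rsubmx x).
Proof. by have [t [x' ->]] := cons_rVP x; rewrite cons_rV0 row_mxKr. Qed.

(** With [y k] along the first axis, the new segment lengthens every line over the projection of the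
    zonotope, and that projection is the zonotope of the tails. *)
Lemma volume_zonotopeU1 n (I : finType) (y : I -> 'rV[R]_(1 + n)) (D : {set I}) k c :
    k \notin D -> c != 0 -> y k = cons_rV c 0 ->
  (volume (n := n.+1) (zonotope y D) +
     (`|c| *+ 2)%:E * volume (n := n) (zonotope (fun j => rsubmx (y j)) D) <=
   volume (n := n.+1) (zonotope y (k |: D)))%E.
Proof.
move=> kD c0 yk; apply: volume_slab.
- exact: zonotope_compact.
- exact: zonotope_closed.
- exact: zonotope_closed.
- move=> _ [t t1 ->]; exists (\sum_(j in D) t j * y j 0 0).
  exists t => //; rewrite -sum_cons_rV; apply: eq_bigr => j _.
  by rewrite [in RHS](cons_rV_hd_tl (y j)).
- move=> t t' s x Bt Bt' /andP[ts st'].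
  have [tt'|tt'] := eqVneq t t'.
    by have -> : s = t by apply: le_anti; rewrite ts tt' st'.
  have d0 : 0 < t' - t by rewrite subr_gt0 lt_neqAle tt' (le_trans ts).
  have := zonotope_convex Bt Bt' (p := (t' - s) / (t' - t)).
  have -> : (t' - s) / (t' - t) *: cons_rV t x + (1 - (t' - s) / (t' - t)) *: cons_rV t' x
       = cons_rV s x.
    have E a : a *: cons_rV t x + (1 - a) *: cons_rV t' x = cons_rV (a * t + (1 - a) * t') x.
      by rewrite !cons_rVZ cons_rVD -scalerDl (addrC a (1 - a)) subrK scale1r.
    by rewrite E; congr cons_rV; field; exact: lt0r_neq0.
  apply; rewrite ler_pdivrMr// mul1r lerD2l lerN2 ts andbT.
  by rewrite divr_ge0 ?(ltW d0)// subr_ge0.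
- move=> t s x sc Bt.
  have -> : cons_rV (t + s) x = cons_rV t x + (s / c) *: y k.
    by rewrite yk cons_rVZ cons_rVD divfK// scaler0 addr0.
  by apply: zonotope_shift => //; rewrite normf_div ler_pdivrMr ?normr_gt0// mul1r.
Qed.

Lemma norm_det_cons n (f : 'I_n.+1 -> 'rV[R]_(1 + n)) i c : f i = cons_rV c 0 ->
  `|\det (\matrix_k f k)| = `|c| * `|\det (\matrix_k rsubmx (f (lift i k)))|.
Proof.
move=> fi; rewrite (expand_det_row _ i) (bigD1 0)//= big1 => [|j j0]; last first.
  rewrite mxE fi; case: (unliftP 0 j) j0 => [l|] ->; last by rewrite eqxx.
  by rewrite cons_rVS mxE mul0r.
rewrite addr0 mxE fi cons_rV0 /cofactor normrM normrM normrX normrN1 expr1n mul1r.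
congr (_ * `|\det _|); apply/matrixP => k l; rewrite !mxE; congr (f _ _ _).
exact/val_inj.
Qed.

Definition insert_ffun (I : finType) n (i : 'I_n.+1) (k : I) (g : {ffun 'I_n -> I}) :
    {ffun 'I_n.+1 -> I} :=
  [ffun j => if unlift i j is Some j' then g j' else k].

Lemma insert_ffun_eq (I : finType) n (i : 'I_n.+1) (k : I) g : insert_ffun i k g i = k.
Proof. by rewrite ffunE unlift_none. Qed.

Lemma insert_ffun_lift (I : finType) n (i : 'I_n.+1) (k : I) g j :
  insert_ffun i k g (lift i j) = g j.
Proof. by rewrite ffunE liftK. Qed.

(** A tuple avoids [k], or takes it once and is then an insertion of [k] into a tuple from [D], or
    takes it twice and has [F f = 0]. *)
Lemma sum_ffunU1_le (I : finType) n (D : {set I}) (k : I)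
    (F : {ffun 'I_n.+1 -> I} -> R) :
    (forall f, 0 <= F f) ->
    (forall (f : {ffun 'I_n.+1 -> I}) i j, i != j -> f i = k -> f j = k -> F f = 0) ->
  \sum_(f : {ffun 'I_n.+1 -> I} | [forall i, f i \in k |: D]) F f <=
  \sum_(f : {ffun 'I_n.+1 -> I} | [forall i, f i \in D]) F f +
  \sum_(i < n.+1) \sum_(g : {ffun 'I_n -> I} | [forall i, g i \in D]) F (insert_ffun i k g).
Proof.
move=> F0 Fk.
(* Written as a sum over [f] with indicators, the last term can be compared with the others one [f]
   at a time. *)
have -> : \sum_(i < n.+1) \sum_(g : {ffun 'I_n -> I} | [forall i, g i \in D])
      F (insert_ffun i k g) =
    \sum_f \sum_(i < n.+1) \sum_(g : {ffun 'I_n -> I} | [forall i, g i \in D])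
      (f == insert_ffun i k g)%:R * F f.
  rewrite [RHS]exchange_big; apply: eq_bigr => i _; rewrite [RHS]exchange_big.
  apply: eq_bigr => g _; rewrite [RHS](bigD1 (insert_ffun i k g))//= eqxx mul1r.
  by rewrite big1 ?addr0// => f /negbTE ->; rewrite mul0r.
rewrite big_mkcond [X in _ <= X + _]big_mkcond -big_split; apply: ler_sum => f _ /=.
have S0 i : 0 <= \sum_(g : {ffun 'I_n -> I} | [forall i, g i \in D])
      (f == insert_ffun i k g)%:R * F f.
  by apply: sumr_ge0 => g _; rewrite mulr_ge0.
have SS0 : 0 <= \sum_(i < n.+1) \sum_(g : {ffun 'I_n -> I} | [forall i, g i \in D])
      (f == insert_ffun i k g)%:R * F f by apply: sumr_ge0.
case: forallP => fkD; last by rewrite addr_ge0//; case: ifP.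
case: forallP => fD; first by rewrite lerDl.
have [/eqP ->|Fn0] := boolP (F f == 0).
  by rewrite add0r; apply: sumr_ge0 => i _; apply: sumr_ge0 => g _; rewrite mulr0.
have [i fi] : exists i, f i = k.
  apply: contrapT => nk; apply: fD => i.
  by have := fkD i; rewrite !inE => /orP[/eqP fik|//]; case: nk; exists i.
pose g : {ffun 'I_n -> I} := [ffun j => f (lift i j)].
have fg : f = insert_ffun i k g.
  apply/ffunP => j; case: (unliftP i j) => [l|] ->.
    by rewrite insert_ffun_lift ffunE.
  by rewrite insert_ffun_eq.
rewrite add0r (bigD1 i)//= (bigD1 g)/=; last first.
  apply/forallP => j; rewrite ffunE; have := fkD (lift i j); rewrite !inE.
  move=> /orP[/eqP fk|//]; case/negP: Fn0; apply/eqP.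
  by apply: (Fk f i (lift i j)) => //; exact: neq_lift.
rewrite -fg eqxx mul1r -addrA lerDl addr_ge0//; apply: sumr_ge0 => //.
by move=> h _; rewrite mulr_ge0.
Qed.

Lemma volume_le n (A B : set 'rV[R]_n) : closed A -> closed B -> A `<=` B ->
  (volume (n := n) A <= volume (n := n) B)%E.
Proof.
move=> cA cB AB; apply: le_measure; rewrite ?inE; [exact: measurable_closed..|].
by move=> u /AB.
Qed.

Lemma volume_ge0 n (A : set 'rV[R]_n) : (0 <= volume (n := n) A)%E.
Proof. exact: measure_ge0. Qed.

(** Induction on [n], then on the size of [D]: adding a segment increases both sides by a term of
    dimension one less, through [volume_zonotopeU1] for the volume and through Laplace expansion
    along the row [y k] for the determinants. *)
Lemma zonotope_volume n (I : finType) (y : I -> 'rV[R]_n) (D : {set I}) :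
  ((2 ^+ n * \sum_(f : {ffun 'I_n -> I} | [forall i, f i \in D])
      `|\det (\matrix_i y (f i))|)%:E <=
   (n`!%:R)%:E * volume (n := n) (zonotope y D))%E.
Proof.
elim: n y D => [|n IH] y D.
  rewrite expr0 mul1r fact0 mul1e.
  have -> : volume (n := 0) (zonotope y D) = 1%E.
    rewrite /volume/= diracE mem_set//=; exists (fun=> 0) => [k|]; first by rewrite normr0.
    by rewrite [RHS]thinmx0.
  rewrite lee_fin; apply: (@le_trans _ _ (\sum_(f : {ffun 'I_0 -> I}) 1)).
    rewrite big_mkcond; apply: ler_sum => f _; case: ifP => // _.
    by rewrite det_mx00 normr1.
  by rewrite sumr_const card_ffun card_ord expn0.
have [m] := ubnP #|D|; elim: m D => // m IHm D.
have [->|[k kD]] := set_0Vmem D.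
  move=> _; rewrite big1 ?mulr0; last first.
    by move=> f /forallP/(_ 0); rewrite inE.
  by rewrite mule_ge0 ?lee_fin// volume_ge0.
have [D' kD' ->] : exists2 D' : {set I}, k \notin D' & D = k |: D'.
  by exists (D :\ k); [rewrite !inE eqxx|rewrite finset.setD1K].
rewrite cardsU1 kD' add1n ltnS => /IHm {IHm kD}.
move: D' kD' => {}D kD IHD.
pose F (f : {ffun 'I_n.+1 -> I}) : R := `|\det (\matrix_i y (f i))|.
have Fk (f : {ffun 'I_n.+1 -> I}) i j : i != j -> f i = k -> f j = k -> F f = 0.
  move=> ij fi fj; rewrite /F (determinant_alternate ij) ?normr0// => l.
  by rewrite !mxE fi fj.
have F0 f : 0 <= F f by exact: normr_ge0.
have Fle := sum_ffunU1_le D F0 Fk.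
(* If [y k] is 0, tuples through [k] have determinant 0 and the zonotope does not shrink. *)
have [yk0|/exists_shear[T [detT volT [c c0 yTc]]]] := eqVneq (y k) 0.
  apply: (@le_trans _ _ (n.+1`!%:R%:E * volume (n := n.+1) (zonotope y D))%E); last first.
    apply: lee_wpmul2l; first by rewrite lee_fin.
    apply: (@volume_le n.+1); [exact: zonotope_closed..|] => x zx.
    by rewrite -(addr0 x) -(scaler0 _ 1) -yk0; apply: zonotope_shift; rewrite ?normr1.
  apply: le_trans IHD; rewrite lee_fin ler_pM2l ?exprn_gt0// (le_trans Fle)//.
  rewrite [X in _ + X]big1 ?addr0// => i _; rewrite big1// => g _.
  apply/eqP; rewrite /F normr_eq0; apply/eqP.
  rewrite (expand_det_row _ i) big1// => j _.
  by rewrite mxE insert_ffun_eq yk0 mxE mul0r.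
(* The map [T] puts [y k] on the first axis while keeping volumes and determinants. *)
pose y' j := y j *m T.
have volE E : volume (n := n.+1) (zonotope y E) = volume (n := n.+1) (zonotope y' E).
  rewrite -[RHS]volT; last exact: zonotope_closed.
  apply: (@volume_ext _ n.+1); apply/seteqP; split=> x.
    by move=> zx; rewrite /= zonotope_mulmx; exists x.
  have Tu : T \in unitmx by rewrite unitmxE detT unitr1.
  by rewrite /= zonotope_mulmx => -[z zz /(can_inj (mulmxK Tu)) <-].
have Uv := volume_zonotopeU1 (y := y') kD c0 yTc.
rewrite !volE in IHD *.
apply: (@le_trans _ _ (n.+1`!%:R%:E * (volume (n := n.+1) (zonotope y' D) +
     (`|c| *+ 2)%:E * volume (n := n) (zonotope (fun j => rsubmx (y' j)) D)))%E); last first.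
  by apply: lee_wpmul2l => //; rewrite lee_fin.
rewrite ge0_muleDr ?volume_ge0 ?mule_ge0 ?lee_fin ?volume_ge0 ?mulrn_wge0//.
apply: (@le_trans _ _ ((2 ^+ n.+1 * \sum_(f : {ffun 'I_n.+1 -> I} | [forall i, f i \in D]) F f)%:E +
   (2 ^+ n.+1 * \sum_(i < n.+1) \sum_(g : {ffun 'I_n -> I} | [forall i, g i \in D])
      F (insert_ffun i k g))%:E)%E).
  by rewrite -EFinD lee_fin -mulrDr ler_pM2l ?exprn_gt0.
apply: leeD; first exact: IHD.
(* The factor n + 1 gained by the factorial matches the n + 1 places at which [k] can be
   inserted. *)
rewrite muleA -EFinM factS natrM.
have -> : (n.+1%:R * n`!%:R * (`|c| *+ 2) : R) = (n.+1%:R * `|c| *+ 2) * n`!%:R by ring.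
rewrite [X in (_ <= X * _)%E]EFinM -muleA.
have Fins i g : F (insert_ffun i k g) =
    `|c| * `|\det (\matrix_j rsubmx (y' (g j)))|.
  have -> : F (insert_ffun i k g) = `|\det (\matrix_j y' (insert_ffun i k g j))|.
    rewrite /F -[X in `|X|]mulr1 -detT -det_mulmx; congr `|\det _|.
    by apply/row_matrixP => j; rewrite row_mul !rowK.
  rewrite (@norm_det_cons _ _ i c) ?insert_ffun_eq//; congr (_ * `|\det _|).
  by apply/row_matrixP => j; rewrite !rowK insert_ffun_lift.
under eq_bigr do under eq_bigr do rewrite Fins.
under eq_bigr do rewrite -mulr_sumr.
rewrite sumr_const card_ord.
have := lee_wpmul2l (x := (n.+1%:R * `|c| *+ 2)%:E) _ (IH (fun j => rsubmx (y' j)) D).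
rewrite lee_fin mulrn_wge0 ?mulr_ge0// => /(_ isT); apply: le_trans.
rewrite -EFinM lee_fin le_eqVlt; apply/orP; left; apply/eqP.
by rewrite exprS -mulr_natl; ring.
Qed.

End Zonotope.

(** * Concentration of near-extremal systems *)

Section Concentration.
Variable R : realType.

(** Cramer's rule: exchanging one vector of a frame gives a determinant that is linear in the new
    vector. *)
Lemma det_replace_row n (f : 'I_n -> 'rV[R]_n) (u : 'rV[R]_n) i :
  \det (\matrix_k (if k == i then u else f k)) = (u *m \adj (\matrix_k f k)) 0 i.
Proof.
rewrite (expand_det_row _ i) mxE; apply: eq_bigr => l _.
rewrite mxE eqxx [in RHS]mxE; congr (_ * _); rewrite /cofactor; congr (_ * \det _).
by apply/matrixP => a b; rewrite !mxE eq_sym (negbTE (neq_lift _ _)).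
Qed.

Definition update_ffun (I : finType) n (f : {ffun 'I_n -> I}) i j : {ffun 'I_n -> I} :=
  [ffun k => if k == i then j else f k].

Lemma det_update_ffun (I : finType) n (x : I -> 'rV[R]_n) (f : {ffun 'I_n -> I}) i j :
  \det (\matrix_k x (update_ffun f i j k)) = (x j *m \adj (\matrix_k x (f k))) 0 i.
Proof.
rewrite -det_replace_row; congr (\det _); apply/row_matrixP => k.
by rewrite !rowK ffunE; case: eqP.
Qed.

(** Swapping the value of [f] at [i] with [j] is an involution of the pairs (f, j), and it separates
    the two factors. *)
Lemma sum_update_ffun (I : finType) n (b : {ffun 'I_n -> I} -> R) (w : I -> R) i :
  \sum_f \sum_j b (update_ffun f i j) * w (f i) = (\sum_f b f) * \sum_j w j.
Proof.
rewrite mulr_suml; under [RHS]eq_bigr do rewrite mulr_sumr.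
rewrite !pair_bigA.
pose h (p : {ffun 'I_n -> I} * I) := (update_ffun p.1 i p.2, p.1 i).
have hK : involutive h.
  move=> [f j]; rewrite /h /= ffunE eqxx; congr (_, _).
  by apply/ffunP => k; rewrite !ffunE; case: eqP => // ->.
by rewrite [RHS](reindex_inj (inv_inj hK)).
Qed.

Lemma l2norm_sum n (I : Type) (r : seq I) (P : pred I) (y : I -> 'rV[R]_n) :
  l2norm (\sum_(k <- r | P k) y k) <= \sum_(k <- r | P k) l2norm (y k).
Proof.
elim/big_rec2: _ => [|k a b _ le_ab].
  by rewrite /l2norm dotE mul0mx mxE sqrtr0.
by apply: le_trans (ler_l2normD _ _) _; rewrite lerD2l.
Qed.

(* Averaging over all [f], with [y j] in place of [y (f i)], selects one frame
   [x (f _)] that works for almost all of the mass of [y]. *)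
Lemma concentration n (I : finType) (x y : I -> 'rV[R]_n) (m d lam : R) :
    (forall k, dot (x k) (x k) <= 1) ->
    \sum_k (x k)^T *m y k = 1%:M ->
    \sum_(f : {ffun 'I_n -> I}) `|\det (\matrix_i y (f i))| <= n`!%:R * (1 + d) ->
    \sum_k l2norm (y k) <= m -> 0 <= m -> 0 < lam -> lam * (n%:R * m + 1) * d < 1 ->
  exists f : {ffun 'I_n -> I},
    lam * (1 - `|\det (\matrix_i x (f i))|) < 1 /\
    forall (J : {set I}) (kap : R), 0 < kap ->
      (forall j i, j \in J ->
         kap <= 1 - `|(x j *m \adj (\matrix_k x (f k))) 0 i|) ->
      \sum_(j in J) l2norm (y j) <= (kap * lam)^-1.
Proof.
move=> x1 xy Uy ym m0 lam0 small.
pose a (f : {ffun 'I_n -> I}) : R := `|\det (\matrix_i y (f i))|.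
pose dx (f : {ffun 'I_n -> I}) : R := `|\det (\matrix_i x (f i))|.
have a0 f : 0 <= a f by exact: normr_ge0.
have dx1 f : dx f <= 1 by apply: det_le1.
pose b f := a f * (1 - dx f).
have b0 f : 0 <= b f by rewrite mulr_ge0// subr_ge0.
(* Total weighted defect of the frames got from [f] by exchanging one index, each counted with the
   norm of the vector removed. *)
pose G f := \sum_i \sum_j b (update_ffun f i j) * l2norm (y (f i)).
have CB : n`!%:R <= \sum_f a f * dx f.
  have -> : n`!%:R = n`!%:R * \det (\sum_k (x k)^T *m y k) :> R by rewrite xy det1 mulr1.
  rewrite -cauchy_binet; apply: ler_sum => f _.
  by rewrite (le_trans (ler_norm _))// normrM mulrC.
have ale : n`!%:R <= \sum_f a f.
  by apply: le_trans CB _; apply: ler_sum => f _; rewrite ler_piMr.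
have Db : \sum_f b f <= n`!%:R * d.
  rewrite /b; under eq_bigr do rewrite mulrBr mulr1.
  rewrite sumrB lerBlDr; apply: le_trans Uy _.
  by rewrite mulrDr mulr1 addrC lerD2l.
have SG : \sum_f G f <= n%:R * m * (n`!%:R * d).
  rewrite /G exchange_big /=; under eq_bigr do rewrite (sum_update_ffun b (fun k => l2norm (y k))).
  rewrite sumr_const card_ord -[X in X <= _]mulr_natl -mulrA ler_wpM2l// mulrC ler_pM//.
  - by apply: sumr_ge0 => k _; exact: l2norm_ge0.
  - by apply: sumr_ge0.
have nf0 : 0 < n`!%:R :> R by rewrite ltr0n fact_gt0.
(* Otherwise summing over [f] would give n! <= lam (n m + 1) n! d, against [small]. *)
have [f Hf] : exists f, lam * G f + lam * b f < a f.
  apply: contrapT => nf; have : \sum_f a f <= \sum_f (lam * G f + lam * b f).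
    by apply: ler_sum => f _; rewrite leNgt; apply/negP => h; apply: nf; exists f.
  rewrite big_split /= -!mulr_sumr leNgt => /negP; apply.
  apply: (lt_le_trans _ ale); rewrite -mulrDr.
  apply: (@le_lt_trans _ _ (lam * (n%:R * m * (n`!%:R * d) + n`!%:R * d))).
    by rewrite ler_pM2l// lerD.
  have -> : lam * (n%:R * m * (n`!%:R * d) + n`!%:R * d) =
     n`!%:R * (lam * (n%:R * m + 1) * d) by ring.
  by rewrite gtr_pMr.
have G0 : 0 <= G f.
  by apply: sumr_ge0 => i _; apply: sumr_ge0 => j _; rewrite mulr_ge0// l2norm_ge0.
have af0 : 0 < a f.
  by apply: le_lt_trans Hf; rewrite addr_ge0// mulr_ge0// ltW.
have Gf : lam * G f < a f.
  by apply: le_lt_trans Hf; rewrite lerDl mulr_ge0// ltW.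
exists f; split.
  rewrite -(ltr_pM2l af0) mulr1; apply: le_lt_trans Hf.
  by rewrite mulrCA lerDr mulr_ge0// ltW.
move=> J kap kap0 HJ.
(* Cramer's rule expands det M times [y j] in the vectors [y (f i)], with the exchanged determinants
   as coefficients. *)
have yle j : a f * l2norm (y j) <= \sum_i a (update_ffun f i j) * l2norm (y (f i)).
  set M := \matrix_i y (f i).
  have E : \det M *: y j = \sum_i (y j *m \adj M) 0 i *: y (f i).
    rewrite -mul_mx_scalar -mul_adj_mx mulmxA mulmx_sum_row.
    by apply: eq_bigr => i _; rewrite rowK.
  rewrite /a -l2normZ E; apply: le_trans (l2norm_sum _ _ _) _.
  by apply: ler_sum => i _; rewrite det_update_ffun l2normZ.
(* For [j] in [J] every exchanged frame has defect at least [kap], so [yle] bounds the mass on [J]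
   by [G f]. *)
have GJ : \sum_(j in J) kap * (a f * l2norm (y j)) <= G f.
  rewrite /G exchange_big /= [X in X <= _]big_mkcond; apply: ler_sum => j _.
  case: ifP => jJ; last by apply: sumr_ge0 => i _; rewrite mulr_ge0// l2norm_ge0.
  apply: (le_trans (ler_wpM2l (ltW kap0) (yle j))).
  rewrite mulr_sumr; apply: ler_sum => i _; rewrite mulrA ler_wpM2r ?l2norm_ge0//.
  by rewrite mulrC ler_wpM2l// /dx det_update_ffun HJ.
rewrite -mulr_sumr -mulr_sumr in GJ.
rewrite -[leRHS]mul1r ler_pdivlMr ?mulr_gt0// -(ler_pM2l af0) mulr1.
apply: le_trans (ltW Gf); rewrite mulrA [X in X <= _]mulrC.
by rewrite (mulrC kap) -mulrA ler_pM2l.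
Qed.

End Concentration.

(** * A renorming of R^N *)

(* An alias of 'rV[R]_N that carries [x] and [c], which determine its norm. *)
Definition renorm (R : realType) (n N : nat) (x : 'I_N -> l2 R n) (c : R) : Type :=
  'rV[R]_N.

HB.instance Definition _ (R : realType) (n N : nat) (x : 'I_N -> l2 R n) (c : R) :=
  GRing.Lmodule.on (renorm x c).

Section Renorm.
Variables (R : realType) (n N : nat) (x : 'I_N -> l2 R n) (c : R).

Definition sup_norm (y : 'rV[R]_N) : R := `|y|.

Lemma sup_norm_ge0 y : 0 <= sup_norm y. Proof. exact: normr_ge0. Qed.

Lemma sup_norm_coord (y : 'rV[R]_N) k : `|y 0 k| <= sup_norm y.
Proof.
by rewrite /sup_norm /Num.norm /= mx_normrE; apply: (le_bigmax _ _ (0, k)).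
Qed.

Lemma sup_norm_le (y : 'rV[R]_N) a : 0 <= a -> (forall k, `|y 0 k| <= a) -> sup_norm y <= a.
Proof.
move=> a0 ya; rewrite /sup_norm /Num.norm /= mx_normrE; apply/bigmax_leP; split=> // -[i k] _.
by rewrite /= ord1.
Qed.

Definition dots (z : l2 R n) : 'rV[R]_N := \row_k dot z (x k).

Lemma dotsD z z' : dots (z + z') = dots z + dots z'.
Proof. by apply/rowP => k; rewrite !mxE dotDl. Qed.

Lemma dotsZ a z : dots (a *: z) = a *: dots z.
Proof. by apply/rowP => k; rewrite !mxE dotZl. Qed.

Lemma dots0 : dots 0 = 0.
Proof. by rewrite -(scale0r (0 : l2 R n)) dotsZ scale0r. Qed.

Lemma l2norm0 : l2norm (0 : l2 R n) = 0.
Proof. by rewrite -(scale0r (0 : l2 R n)) l2normZ normr0 mul0r. Qed.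

(* The unit ball of [inf_norm] is, up to closure, the convex hull of the image of
   the Euclidean ball and of the cube of half-side [`|c|^-1]. *)
Definition inf_norm (y : 'rV[R]_N) : R :=
  inf [set l2norm z + `|c| * sup_norm (y - dots z) | z in [set: l2 R n]].

Lemma inf_norm_has_inf y :
  has_inf [set l2norm z + `|c| * sup_norm (y - dots z) | z in [set: l2 R n]].
Proof.
split; first by exists (l2norm (0 : l2 R n) + `|c| * sup_norm (y - dots 0)), 0.
by exists 0 => _ [z _ <-]; rewrite addr_ge0 ?l2norm_ge0// mulr_ge0// sup_norm_ge0.
Qed.

Lemma inf_norm_le y z : inf_norm y <= l2norm z + `|c| * sup_norm (y - dots z).
Proof. by apply: ge_inf; [case: (inf_norm_has_inf y)|exists z]. Qed.

Lemma le_inf_norm y a :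
  (forall z, a <= l2norm z + `|c| * sup_norm (y - dots z)) -> a <= inf_norm y.
Proof.
move=> h; apply: lb_le_inf; first by case: (inf_norm_has_inf y).
by move=> _ [z _ <-].
Qed.

Lemma inf_norm_ge0 y : 0 <= inf_norm y.
Proof.
by apply: le_inf_norm => z; rewrite addr_ge0 ?l2norm_ge0// mulr_ge0// sup_norm_ge0.
Qed.

Lemma ler_inf_normD y y' : inf_norm (y + y') <= inf_norm y + inf_norm y'.
Proof.
rewrite -lerBlDr; apply: le_inf_norm => z; rewrite lerBlDr -lerBlDl.
apply: le_inf_norm => z'; rewrite lerBlDl; apply: le_trans (inf_norm_le _ (z + z')) _.
rewrite addrACA -mulrDr lerD ?ler_l2normD// ler_wpM2l//.
by rewrite dotsD opprD addrACA; exact: ler_normD.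
Qed.

Lemma inf_normZ a y : inf_norm (a *: y) = `|a| * inf_norm y.
Proof.
have le b w : inf_norm (b *: w) <= `|b| * inf_norm w.
  have [->|b0] := eqVneq b 0.
    rewrite normr0 mul0r scale0r (le_trans (inf_norm_le _ 0))//.
    by rewrite dots0 subrr l2norm0 add0r /sup_norm normr0 mulr0.
  have nb : 0 < `|b| by rewrite normr_gt0.
  rewrite -ler_pdivrMl//; apply: le_inf_norm => z; rewrite ler_pdivrMl//.
  apply: le_trans (inf_norm_le _ (b *: z)) _.
  by rewrite l2normZ dotsZ -scalerBr /sup_norm normrZ mulrDr mulrCA.
have [->|a0] := eqVneq a 0.
  by apply/eqP; rewrite eq_le le normr0 mul0r scale0r inf_norm_ge0.
apply/eqP; rewrite eq_le le/= -ler_pdivlMl ?normr_gt0//.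
by rewrite -normfV -{1}[y](scalerK a0) le.
Qed.

(* The maximum makes this a norm without any assumption on [x] and [c]. *)
Definition renorm_norm (y : renorm x c) : R := Num.max (sup_norm y) (inf_norm y).

Lemma ler_renormD (y y' : renorm x c) : renorm_norm (y + y') <= renorm_norm y + renorm_norm y'.
Proof.
rewrite ge_max; apply/andP; split.
  by apply: le_trans (ler_normD _ _) _; rewrite lerD// le_max lexx.
by apply: le_trans (ler_inf_normD _ _) _; rewrite lerD// le_max lexx orbT.
Qed.

Lemma renormZ a (y : renorm x c) : renorm_norm (a *: y) = `|a| * renorm_norm y.
Proof. by rewrite /renorm_norm maxr_pMr// inf_normZ /sup_norm normrZ. Qed.

Lemma renorm_eq0 (y : renorm x c) : renorm_norm y = 0 -> y = 0.
Proof.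
move=> y0; apply: (@normr0_eq0 R 'rV[R]_N); apply: le_anti; rewrite normr_ge0 andbT.
by rewrite -[leRHS]y0 le_max lexx.
Qed.

HB.instance Definition _ :=
  Lmodule_isNormed.Build R (renorm x c) ler_renormD renormZ renorm_eq0.

Lemma renorm_normE (y : renorm x c) : `|y| = renorm_norm y. Proof. by []. Qed.

Lemma renorm_le (y : renorm x c) : `|y| <= (1 + `|c|) * sup_norm y.
Proof.
rewrite renorm_normE ge_max mulrDl mul1r lerDl mulr_ge0 ?sup_norm_ge0//=.
apply: le_trans (inf_norm_le y 0) _.
by rewrite dots0 subr0 l2norm0 add0r lerDr sup_norm_ge0.
Qed.

(** The norm lies between [sup_norm] and a constant multiple of it, so completeness is inherited
    from the sup norm. *)
Lemma renorm_complete (F : set_system (renorm x c)) : ProperFilter F -> cauchy F -> cvg F.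
Proof.
move=> FF /cauchyP Fc.
have Fc' : cauchy (F : set_system 'rV[R]_N).
  apply/cauchyP => e e0; have [y Fy] := Fc e e0; exists y.
  apply: filterS Fy => z; rewrite -!ball_normE /=; apply: le_lt_trans.
  by rewrite renorm_normE le_max lexx.
have /cvg_ex[l Fl] := (@cauchy_cvg 'rV[R]_N F FF Fc').
apply/cvg_ex; exists l; apply/cvg_ballP => e e0.
have c0 : 0 < 1 + `|c| by rewrite ltr_pwDl.
have /cvg_ballP/(_ (e / (1 + `|c|))) := Fl.
rewrite divr_gt0// => /(_ isT); apply: filterS => z; rewrite -!ball_normE /=.
rewrite ltr_pdivlMr// mulrC; apply: le_lt_trans; exact: renorm_le.
Qed.

HB.instance Definition _ := Uniform_isComplete.Build (renorm x c) renorm_complete.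

Definition dots_renorm (z : l2 R n) : renorm x c := dots z.

Lemma dots_renorm_linear : linear dots_renorm.
Proof. by move=> a u v; rewrite /dots_renorm dotsD dotsZ. Qed.

HB.instance Definition _ :=
  GRing.isLinear.Build R (l2 R n) (renorm x c) _ dots_renorm dots_renorm_linear.

Hypothesis x1 : forall k, dot (x k) (x k) <= 1.
Hypothesis c1 : 1 <= c.
Hypothesis xc : forall v : l2 R n, exists k, l2norm v <= c * `|dot v (x k)|.

Lemma norm_dot_le (u v : l2 R n) : `|dot u v| <= l2norm u * l2norm v.
Proof.
rewrite ler_norml dot_le_l2norm andbT lerNl -mulN1r -dotZl.
by apply: le_trans (dot_le_l2norm _ _) _; rewrite l2normZ normrN1 mul1r.
Qed.

Lemma l2norm_le1 (u : l2 R n) : dot u u <= 1 -> l2norm u <= 1.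
Proof. by move=> u1; rewrite -sqrtr1 ler_sqrt. Qed.

Lemma sup_norm_dots z : sup_norm (dots z) <= l2norm z.
Proof.
apply: sup_norm_le; first exact: l2norm_ge0.
move=> k; rewrite mxE; apply: le_trans (norm_dot_le _ _) _.
by rewrite ler_piMr ?l2norm_ge0// l2norm_le1.
Qed.

Lemma le_sup_norm_dots z : l2norm z <= c * sup_norm (dots z).
Proof.
have [k zk] := xc z; apply: le_trans zk _; rewrite ler_wpM2l ?(le_trans ler01)//.
by rewrite (le_trans _ (sup_norm_coord _ k))// mxE.
Qed.

(** Taking [z] itself in the infimum gives one bound. For the other, [xc] makes the penalty at least
    [l2norm (z - z')], so no [z'] does better than [z]. *)
Lemma dots_isometry : @linear_isometry R (l2 R n) (renorm x c) dots_renorm.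
Proof.
move=> z; rewrite renorm_normE; apply/eqP; rewrite eq_le; apply/andP; split.
  rewrite ge_max sup_norm_dots/=; apply: le_trans (inf_norm_le _ z) _.
  by rewrite subrr /sup_norm normr0 mulr0 addr0.
rewrite le_max; apply/orP; right; apply: le_inf_norm => z'.
have -> : dots z - dots z' = dots (z - z').
  by rewrite -[- dots z']scaleN1r -dotsZ -dotsD scaleN1r.
rewrite (ger0_norm (le_trans ler01 c1)).
rewrite -{1}(subrK z' z) addrC; apply: le_trans (ler_l2normD _ _) _.
by rewrite lerD2l le_sup_norm_dots.
Qed.

Lemma enlargement_frame (A : set (l2 R n)) : sufficient_enlargement A ->
  exists y : 'I_N -> 'rV[R]_n, \sum_k (x k)^T *m y k = 1%:M /\
    forall t : 'I_N -> R, (forall k, `|t k| <= 1) ->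
      A (c^-1 *: \sum_k t k *: y k).
Proof.
move=> [_ /(_ (renorm x c) dots_renorm dots_isometry)[P [[_ PP rP] PA]]].
have Pr (z : renorm x c) : {y | dots_renorm y = P z}.
  apply/cid; have : range P (P z) by exists z.
  by rewrite rP => -[y _ <-]; exists y.
have dinj u v : dots_renorm u = dots_renorm v -> u = v.
  move=> uv; apply/eqP; rewrite -subr_eq0; apply/eqP/l2norm_eq0.
  apply: le_anti; rewrite l2norm_ge0 andbT; apply: le_trans (le_sup_norm_dots _) _.
  have -> : dots (u - v) = dots_renorm u - dots_renorm v by rewrite -raddfB.
  by rewrite uv subrr /sup_norm normr0 mulr0.
have PK u : P (dots_renorm u) = dots_renorm u.
  have : range P (dots_renorm u) by rewrite rP; exists u.
  by move=> [z _ <-]; rewrite PP.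
have PZ a u : P (a *: u) = a *: P u by exact: linearZ_LR.
have dZ a u : dots_renorm (a *: u) = a *: dots_renorm u by exact: linearZ_LR.
pose e k : renorm x c := delta_mx 0 k.
pose y k := sval (Pr (e k)).
have yE k : dots_renorm (y k) = P (e k) by rewrite /y; case: (Pr (e k)).
have PE (t : 'I_N -> R) : P (\sum_k t k *: e k) = dots_renorm (\sum_k t k *: y k).
  by rewrite !raddf_sum; apply: eq_bigr => k _; rewrite [LHS]PZ -yE; exact/esym/dZ.
have eE (t : 'I_N -> R) : \sum_k t k *: e k = \row_k t k :> 'rV[R]_N.
  by rewrite [RHS]row_sum_delta; apply: eq_bigr => k _; rewrite mxE.
exists y; split.
  apply/row_matrixP => i; rewrite row1.
  have -> : row i (\sum_k (x k)^T *m y k) = \sum_k x k 0 i *: y k.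
    apply/rowP => j; rewrite mxE summxE [RHS]summxE; apply: eq_bigr => k _.
    by rewrite mxE big_ord1 !mxE.
  (* [P] fixes the image of the unit vector number [i] of R^n, whose coordinates are the
     [x k 0 i]. *)
  apply: dinj; rewrite -PE -[RHS]PK; congr (P _); rewrite eE.
  apply/rowP => k; rewrite !mxE /dot (bigD1 i)//= big1.
    by rewrite mxE !eqxx mul1r addr0.
  by move=> j /negbTE ji; rewrite mxE ji andbF mul0r.
move=> t t1.
have c0 : 0 < c by exact: lt_le_trans c1.
have : (P @` @unit_ball R (renorm x c)) (P (c^-1 *: \sum_k t k *: e k)).
  exists (c^-1 *: \sum_k t k *: e k) => //; rewrite /unit_ball /=.
  rewrite normrZ normfV gtr0_norm// ler_pdivrMl// mulr1.
  have e1 : sup_norm (\sum_k t k *: e k) <= 1.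
    by apply: sup_norm_le => // k; rewrite eE mxE.
  (* Taking 0 in the infimum bounds the norm by [c] times the sup norm, which the factor [c^-1]
     compensates. *)
  rewrite renorm_normE ge_max (le_trans e1)//=; apply: le_trans (inf_norm_le _ 0) _.
  by rewrite dots0 subr0 l2norm0 add0r gtr0_norm// -[leRHS]mulr1 ler_pM2l.
move=> /PA[a Aa]; rewrite PZ PE -dZ => /dinj <-.
exact: Aa.
Qed.
End Renorm.

(** * Systems extracted from a sufficient enlargement *)

Section Frames.
Variables (R : realType) (n : nat).

Lemma l2norm_le_sum (z : 'rV[R]_n) : l2norm z <= \sum_i `|z 0 i|.
Proof.
rewrite {1}[z]row_sum_delta; apply: le_trans (l2norm_sum _ _ _) _.
apply: ler_sum => i _; rewrite l2normZ ler_piMr//.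
rewrite /l2norm /dot (bigD1 i)//= big1 ?addr0; last first.
  by move=> j /negbTE ji; rewrite mxE ji andbF mul0r.
by rewrite mxE !eqxx mulr1 sqrtr1.
Qed.

Lemma l2norm_coord (z : 'rV[R]_n) i : `|z 0 i| <= l2norm z.
Proof.
rewrite -sqrtr_sqr ler_wsqrtr// dot_sqrE (bigD1 i)//= lerDl.
by apply: sumr_ge0 => j _; exact: sqr_ge0.
Qed.

(** Round the coordinates of a unit vector [v] towards 0 on a grid of step 1/M: the result stays in
    the ball and its product with [v] is at least 1 - n/M. *)
Lemma ball_net (c : R) : 1 < c ->
  exists N (x : 'I_N -> l2 R n), (forall k, dot (x k) (x k) <= 1) /\
    forall v : l2 R n, exists k, l2norm v <= c * `|dot v (x k)|.
Proof.
move=> c1; have c0 : 0 < c by exact: lt_trans c1.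
have d0 : 0 < c - 1 by rewrite subr_gt0.
(* Chosen so that c (1 - n/M) >= 1. *)
pose M := (Num.truncn (n%:R * c / (c - 1))).+1.
have M0 : 0 < M%:R :> R by rewrite ltr0n.
have Mn : n%:R * c < M%:R * (c - 1).
  by rewrite -ltr_pdivrMr// truncnS_gt.
pose I : finType := {ffun 'I_n -> bool * 'I_M.+1}.
pose p (f : I) : 'rV[R]_n := \row_i ((-1) ^+ (f i).1 * ((f i).2%:R / M%:R)).
pose x (f : I) : l2 R n := if dot (p f) (p f) <= 1 then p f else 0.
have x1 f : dot (x f) (x f) <= 1.
  by rewrite /x; case: ifP => // _; rewrite dotE mul0mx mxE.
have xv (v : 'rV[R]_n) : l2norm v = 1 -> exists f, 1 <= c * dot v (x f).
  move=> v1.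
  have vv : dot v v = 1 by rewrite -sqr_l2norm v1 expr1n.
  have vi (i : 'I_n) : `|v 0 i| <= 1 by rewrite -v1 l2norm_coord.
  have tb (i : 'I_n) : (Num.truncn (M%:R * `|v 0 i|)%R < M.+1)%N.
    by rewrite truncn_lt_nat ?mulr_ge0// (le_lt_trans (ler_wpM2l (ltW M0) (vi i)))// mulr1 ltr_nat.
  pose f : I := [ffun i => (v 0 i < 0, Ordinal (tb i))].
  pose r (i : 'I_n) : R := (Num.truncn (M%:R * `|v 0 i|))%:R / M%:R.
  have r0 (i : 'I_n) : 0 <= r i by rewrite divr_ge0.
  have rv (i : 'I_n) : r i <= `|v 0 i|.
    by rewrite ler_pdivrMr// mulrC truncn_le mulr_ge0.
  have vr (i : 'I_n) : `|v 0 i| - M%:R^-1 <= r i.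
    rewrite lerBlDr /r -[X in _ + X]mul1r -mulrDl ler_pdivlMr// mulrC.
    by rewrite natr1 ltW// truncnS_gt.
  have pf (i : 'I_n) : p f 0 i = (-1) ^+ (v 0 i < 0)%R * r i by rewrite mxE ffunE.
  have pp : dot (p f) (p f) <= 1.
    rewrite -vv !dot_sqrE; apply: ler_sum => i _.
    rewrite pf exprMn sqrr_sign mul1r -[leRHS]real_normK ?num_real//.
    by rewrite ler_pXn2r ?nnegrE.
  exists f; rewrite /x pp.
  have vp : dot v (p f) = \sum_i `|v 0 i| * r i.
    by apply: eq_bigr => i _; rewrite pf mulrA [in RHS]normrEsign [_ * v _ _]mulrC.
  have : 1 - n%:R / M%:R <= dot v (p f).
    rewrite vp lerBlDr -[X in X <= _]vv dot_sqrE.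
    apply: (@le_trans _ _ (\sum_i (`|v 0 i| * r i + M%:R^-1))).
      apply: ler_sum => i _; rewrite -[leLHS]real_normK ?num_real// expr2.
      apply: (@le_trans _ _ (`|v 0 i| * (r i + M%:R^-1))).
        by rewrite ler_wpM2l// -lerBlDr vr.
      by rewrite mulrDr lerD2l ler_piMl// invr_ge0.
    by rewrite big_split/= lerD2l sumr_const card_ord -[leLHS]mulr_natl.
  move=> /(ler_wpM2l (ltW c0)); apply: le_trans.
  rewrite mulrBr mulr1 lerBrDr -lerBrDl mulrA ler_pdivrMr//.
  by rewrite (mulrC c) (mulrC (c - 1)) ltW.
exists #|I|, (fun k => x (enum_val k)); split=> // v.
have [v0|v0] := eqVneq (l2norm v) 0.
  exists (enum_rank ([ffun=> (true, ord0)] : I)); rewrite v0 mulr_ge0// ltW//.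
have nv : l2norm ((l2norm v)^-1 *: v) = 1.
  by rewrite l2normZ normfV (ger0_norm (l2norm_ge0 v)) mulVf.
have [f cf] := xv _ nv; exists (enum_rank f); rewrite enum_rankK.
have v00 : 0 < l2norm v by rewrite lt_neqAle eq_sym v0 l2norm_ge0.
move: cf; rewrite dotZl mulrCA ler_pdivlMl// mulr1 => /le_trans; apply.
by rewrite ler_pM2l// ler_norm.
Qed.

(** A convex function lies below its chord between 0 and 1. *)
Lemma expr1D_le (s : R) k : 0 <= s <= 1 -> (1 + s) ^+ k <= 1 + (2 ^+ k - 1) * s.
Proof.
move=> /andP[s0 s1]; elim: k => [|k IH]; first by rewrite !expr0 subrr mul0r addr0.
rewrite exprS; apply: (le_trans (ler_wpM2l _ IH)); first by rewrite addr_ge0.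
rewrite exprS; have : 1 <= 2 ^+ k :> R by rewrite exprn_ege1 // ler1n.
move: (2 ^+ k) => t t1; rewrite -subr_ge0.
rewrite (_ : _ - _ = (t - 1) * (s * (1 - s))); last by ring.
by rewrite !mulr_ge0 ?subr_ge0.
Qed.

(** Both bounds are stated because for n = 0 the one on [c ^+ n] says nothing about [c]. *)
Lemma expr_near1 (e : R) : 0 < e -> exists c : R, [/\ 1 < c, c <= 1 + e & c ^+ n <= 1 + e].
Proof.
move=> e0; pose s := Num.min 1 (e / 2 ^+ n).
have t1 : 1 <= 2 ^+ n :> R by rewrite exprn_ege1 // ler1n.
have t0 : 0 < 2 ^+ n :> R by rewrite exprn_gt0.
have s0 : 0 < s by rewrite lt_min ltr01 divr_gt0.
have s1 : s <= 1 by rewrite ge_min lexx.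
have se : s * 2 ^+ n <= e by rewrite -ler_pdivlMr// ge_min lexx orbT.
exists (1 + s); split; first by rewrite ltrDl.
- rewrite lerD2l; apply: le_trans se; by rewrite ler_peMr// ltW.
- apply: (le_trans (expr1D_le n _)); first by rewrite s1 ltW.
  rewrite lerD2l; apply: le_trans se; rewrite mulrC ler_pM2l// gerBl//.
Qed.

(** Closedness of [A] is known for the Euclidean norm, while the volume lemmas use the sup norm
    topology on the same vectors; this is the bridge. Dividing by n + 1 covers n = 0. *)
Lemma nbhs_l2_rV (x : 'rV[R]_n) (B : set 'rV[R]_n) :
  nbhs (x : l2 R n) (B : set (l2 R n)) -> nbhs x B.
Proof.
move=> /nbhs_ballP[e /= e0 eB]; apply/nbhs_ballP.
have n0 : 0 < n.+1%:R :> R by rewrite ltr0n.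
exists (e / n.+1%:R) => /=; first by rewrite divr_gt0.
move=> y [_ xy]; apply: eB; rewrite -ball_normE /=.
apply: le_lt_trans (l2norm_le_sum (x - y)) _.
apply: (@le_lt_trans _ _ (\sum_(i < n) (e / n.+1%:R))).
  apply: ler_sum => i _; have := xy 0 i; rewrite -ball_normE /= => /ltW.
  by rewrite !mxE.
rewrite sumr_const card_ord -[X in X < _]mulr_natr -mulrA gtr_pMr//.
by rewrite mulrC ltr_pdivrMr// mul1r ltr_nat.
Qed.

Lemma closed_l2_rV (A : set (l2 R n)) : closed A -> closed (A : set 'rV[R]_n).
Proof.
by move=> cA x clx; apply: cA => B /nbhs_l2_rV xB; exact: clx.
Qed.

(** What the limit argument needs at precision [lam]. The system [x], [y] is existential since its
    size changes with [lam]; the mass bound [m] is a parameter since it must not. *)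
Definition frame_approx (A : set (l2 R n)) (m lam : R) (F : 'I_n -> 'rV[R]_n) : Prop :=
  [/\ forall i, dot (F i) (F i) <= 1, lam * (1 - `|\det (\matrix_i F i)|) < 1 &
    exists N (x y : 'I_N -> 'rV[R]_n) c,
    [/\ (forall k, dot (x k) (x k) <= 1) /\ \sum_k (x k)^T *m y k = 1%:M,
      \sum_k l2norm (y k) <= m, 1 < c <= 1 + lam^-1,
      forall t : 'I_N -> R, (forall k, `|t k| <= 1) -> A (c^-1 *: \sum_k t k *: y k) &
      forall (J : {set 'I_N}) (kap : R), 0 < kap ->
        (forall j i, j \in J -> kap <= 1 - `|(x j *m \adj (\matrix_k F k)) 0 i|) ->
        \sum_(j in J) l2norm (y j) <= (kap * lam)^-1]].

Lemma enlargement_frame_approx (A : set (l2 R n)) :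
  sufficient_enlargement A -> (volume A <= (2 ^+ n)%:E)%E ->
  exists m : R, 0 <= m /\ forall lam, 1 <= lam -> exists F, frame_approx A m lam F.
Proof.
move=> hA vA; have [[bA cA _ _ _] _] := hA.
have [rho [rho0 Arho]] : exists rho : R, 0 <= rho /\ forall a, A a -> l2norm a <= rho.
  have [M [_ MA]] := bA; exists (`|M| + 1); split; first by rewrite addr_ge0.
  move=> a; apply: MA; rewrite (le_lt_trans (ler_norm _))// ltrDl//.
(* Each coordinate has total mass at most c rho <= 2 rho. *)
pose m : R := n%:R * (2 * rho).
have m0 : 0 <= m by rewrite !mulr_ge0.
exists m; split=> // lam lam1; have lam0 : 0 < lam by exact: lt_le_trans lam1.
have K0 : 0 < lam * (n%:R * m + 1) by rewrite mulr_gt0// ltr_wpDl// mulr_ge0.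
have K20 : 0 < 1 + lam * (n%:R * m + 1) by rewrite addr_gt0.
(* The first bound yields c <= 1 + 1/lam, the second makes d = c^n - 1 small enough for
   [concentration]. *)
pose e := Num.min lam^-1 (1 + lam * (n%:R * m + 1))^-1.
have [c [c1 ce cne]] : exists c : R, [/\ 1 < c, c <= 1 + e & c ^+ n <= 1 + e].
  by apply: expr_near1; rewrite lt_min !invr_gt0 lam0.
have c0 : 0 < c by exact: lt_trans c1.
have c2 : c <= 2.
  apply: le_trans ce _; rewrite -[2]/(1 + 1) lerD2l ge_min invf_le1// lam1//.
have [N [x [x1 xc]]] := ball_net c1.
have [y [xy yA]] := enlargement_frame x1 (ltW c1) xc hA.
have ym : \sum_k l2norm (y k) <= m.
  apply: (@le_trans _ _ (\sum_k \sum_i `|y k 0 i|)).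
    by apply: ler_sum => k _; exact: l2norm_le_sum.
  rewrite exchange_big /m -[X in X%:R * _](card_ord n) mulr_natl -sumr_const.
  apply: ler_sum => i _.
  (* With these signs, coordinate [i] of the sum is the sum of the absolute values. *)
  have /Arho : A (c^-1 *: \sum_k (-1) ^+ (y k 0 i < 0)%R *: y k).
    by apply: yA => k; rewrite normrX normrN1 expr1n.
  rewrite l2normZ normfV gtr0_norm// ler_pdivrMl// => h.
  apply: (@le_trans _ _ (c * rho)); last by rewrite ler_wpM2r.
  apply: le_trans (le_trans (l2norm_coord _ i) h).
  rewrite summxE (le_trans _ (ler_norm _))//; apply: ler_sum => k _.
  by rewrite mxE [leLHS]normrEsign.
(* The zonotope of the scaled vectors lies in [A], of volume at most 2^n; undoing the scaling costs
   c^n. *)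
have Uy : \sum_(f : {ffun 'I_n -> 'I_N}) `|\det (\matrix_i y (f i))| <=
    n`!%:R * (1 + (c ^+ n - 1)).
  pose y' k := c^-1 *: y k.
  have /(@le_trans _ _ _ _ _) := zonotope_volume y' [set: 'I_N].
  have ZA : zonotope y' [set: 'I_N] `<=` A.
    move=> _ [t t1 ->]; have := yA t t1; congr A.
    by rewrite scaler_sumr [RHS]big_mkcond; apply: eq_bigr => k _;
      rewrite inE /y' !scalerA mulrC.
  have vZ : (volume (n := n) (zonotope y' [set: 'I_N]) <= (2 ^+ n)%:E)%E.
    by apply: le_trans vA; apply: volume_le ZA; [exact: zonotope_closed|exact: closed_l2_rV].
  move=> /(_ _ (lee_wpmul2l _ vZ)); rewrite lee_fin => /(_ (ler0n _ _)).
  rewrite -EFinM lee_fin [X in _ <= X]mulrC ler_pM2l ?exprn_gt0//.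
  have -> : \sum_(f : {ffun 'I_n -> 'I_N} | [forall i, f i \in [set: 'I_N]%SET])
      `|\det (\matrix_i y' (f i))| =
    (c ^+ n)^-1 * \sum_(f : {ffun 'I_n -> 'I_N}) `|\det (\matrix_i y (f i))|.
    rewrite mulr_sumr; apply: eq_big => [f|f _].
      by apply/forallP => i; rewrite inE.
    have -> : \matrix_i y' (f i) = c^-1 *: \matrix_i y (f i).
      by apply/row_matrixP => i; rewrite rowK linearZ /= rowK.
    by rewrite detZ normrM normrX (@gtr0_norm _ c^-1) ?invr_gt0// exprVn.
  by rewrite ler_pdivrMl ?exprn_gt0// addrC subrK mulrC.
have [//|f [f1 f2]] := concentration x1 xy Uy ym m0 lam0.
  apply: (@le_lt_trans _ _ (lam * (n%:R * m + 1) * (1 + lam * (n%:R * m + 1))^-1)).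
    rewrite ler_pM2l// lerBlDl (le_trans cne)// lerD2l ge_min lexx orbT//.
  by rewrite ltr_pdivrMr// mul1r ltrDr.
exists (fun i => x (f i)); split=> //.
exists N, x, y, c; split=> //.
by rewrite c1 (le_trans ce)// lerD2l ge_min lexx.
Qed.

End Frames.

(** * Passage to the limit *)

Section Limit.
Variables (R : realType) (n : nat).

Lemma prod_continuous (T : topologicalType) (I : Type) (r : seq I) (f : I -> T -> R) :
  (forall i, continuous (f i)) -> continuous (fun t => \prod_(i <- r) f i t).
Proof. by move=> fc; apply: continuous_big => //; exact: mul_continuous. Qed.

Lemma det_continuous (T : topologicalType) k (M : T -> 'M[R]_k) :
  (forall i j, continuous (fun t => M t i j)) -> continuous (fun t => \det (M t)).
Proof.
move=> Mc; apply: sum_continuous => s _.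
have pc : continuous (fun t => \prod_i M t i (s i)).
  by apply: prod_continuous => i; exact: Mc.
by move=> t; apply: cvgM; [exact: cvg_cst|exact: pc].
Qed.

Lemma adj_continuous (T : topologicalType) k (M : T -> 'M[R]_k) :
  (forall i j, continuous (fun t => M t i j)) ->
  forall i j, continuous (fun t => \adj (M t) i j).
Proof.
move=> Mc i j; under [X in continuous X]funext do rewrite mxE /cofactor.
have dc : continuous (fun t => \det (row' j (col' i (M t)))).
  apply: det_continuous => a b; under [X in continuous X]funext do rewrite !mxE.
  exact: Mc.
by move=> t; apply: cvgM; [exact: cvg_cst|exact: dc].
Qed.

(** A cluster point in the cube of n by n matrices with entries in [-1, 1]; determinant, adjugate
    and squared row norms are continuous there. *)
Lemma frame_cluster (F : nat -> 'I_n -> 'rV[R]_n) :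
    (forall p i, dot (F p i) (F p i) <= 1) ->
  exists W : 'I_n -> 'rV[R]_n, forall (e : R) (p0 : nat), 0 < e ->
  exists p, [/\ (p0 <= p)%N, `|\det (\matrix_i F p i) - \det (\matrix_i W i)| < e,
     forall i j, `|(\adj (\matrix_i F p i) - \adj (\matrix_i W i)) i j| < e &
     forall i, `|dot (F p i) (F p i) - dot (W i) (W i)| < e].
Proof.
move=> F1.
pose u p : 'rV[R]_(n * n) := mxvec (\matrix_i F p i).
pose K := [set v : 'rV[R]_(n * n) | forall i, `[-1, 1]%classic (v ord0 i)].
have cK : compact K by apply: (@rV_compact R (n * n) (fun=> `[-1, 1]%classic)) => i; exact: segment_compact.
have uK p : K (u p).
  move=> k; case/mxvec_indexP: k => i j; rewrite /u mxvecE mxE /= in_itv /= -ler_norml.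
  by apply: le_trans (l2norm_coord _ _) (l2norm_le1 (F1 p i)).
have [|v [_ cv]] := cK (u @ \oo) _; first by exists 0%N => // p _; exact: uK.
pose M (v : 'rV[R]_(n * n)) := vec_mx v : 'M[R]_n.
have Mc i j : continuous (fun v => M v i j).
  have -> : (fun v => M v i j) = (fun v => v 0 (mxvec_index i j)).
    by apply/funext => w; rewrite /M mxE.
  exact: (@coord_continuous R 1 (n * n) 0 (mxvec_index i j)).
have Mu p : M (u p) = \matrix_i F p i by rewrite /M mxvecK.
exists (fun i => row i (M v)) => e p0 e0.
have -> : \matrix_i row i (M v) = M v by apply/row_matrixP => i; rewrite rowK.
pose D (w : 'rV[R]_(n * n)) i := dot (row i (M w)) (row i (M w)).
have Dc i : continuous (fun w => D w i).
  have -> : (fun w => D w i) = fun w => \sum_j M w i j * M w i j.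
    by apply/funext => w; apply: eq_bigr => j _; rewrite [row _ _ _ _]mxE.
  apply: sum_continuous => j _ w.
  exact: (@cvgM _ _ _ _ _ _ _ _ (Mc i j w) (Mc i j w)).
have nearP (g : 'rV[R]_(n * n) -> R) : continuous g ->
    \forall w \near v, `|g w - g v| < e.
  move=> /(_ v) /cvgrPdist_lt/(_ e e0); apply: filterS => w; by rewrite distrC.
pose B := [set w | [/\ `|\det (M w) - \det (M v)| < e,
  forall i j, `|(\adj (M w) - \adj (M v)) i j| < e & forall i, `|D w i - D v i| < e]].
have subE (X Y : 'M[R]_n) i j : (X - Y) i j = X i j - Y i j by rewrite !mxE.
have vB : nbhs v B.
  have h1 := nearP _ (det_continuous Mc).
  have h2 : \forall w \near v, forall i j, `|(\adj (M w) - \adj (M v)) i j| < e.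
    have h (ij : 'I_n * 'I_n) : \forall w \near v, `|\adj (M w) ij.1 ij.2 - \adj (M v) ij.1 ij.2| < e.
      exact: (nearP (fun w => \adj (M w) ij.1 ij.2) (@adj_continuous _ _ _ Mc ij.1 ij.2)).
    apply: filterS (@filter_forall _ _ _ _ _ h) => w hw i j.
    by have := hw (i, j); rewrite subE.
  have h3 : \forall w \near v, forall i, `|D w i - D v i| < e.
    exact: (@filter_forall _ _ _ _ _ (fun i => nearP (fun w => D w i) (Dc i))).
  by near=> w; split; near: w.
have uA : (u @ \oo) [set u p | p in [set p | (p0 <= p)%N]].
  by exists p0 => // p /= pp0; exists p.
have [_ [[p p0p <-] [b1 b2 b3]]] := cv _ _ uA vB.
exists p; rewrite -!Mu; split=> // i.
have := b3 i; rewrite /D; congr (`| dot _ _ - _ | < _).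
  by rewrite Mu rowK.
by rewrite Mu rowK.
Unshelve. all: by end_near. Qed.

Lemma mul_rV_trmx (z x y : 'rV[R]_n) : z *m x^T *m y = dot z x *: y.
Proof. by rewrite dotE {1}[z *m x^T]mx11_scalar mul_scalar_mx. Qed.

Lemma orthonormal_mulmxT (w : 'I_n -> 'rV[R]_n) : orthonormal_basis w ->
  (\matrix_i w i) *m (\matrix_i w i)^T = 1%:M.
Proof.
move=> ow; apply/matrixP => i j; rewrite [RHS]mxE -(ow i j) mxE.
by apply: eq_bigr => k _; rewrite !mxE.
Qed.

Lemma mulmx_trmx_rows (w : 'I_n -> 'rV[R]_n) (z : 'rV[R]_n) i :
  (z *m (\matrix_i w i)^T) 0 i = dot z (w i).
Proof. by rewrite mxE; apply: eq_bigr => k _; rewrite !mxE. Qed.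

Lemma orthonormal_expand (w : 'I_n -> 'rV[R]_n) (z : 'rV[R]_n) : orthonormal_basis w ->
  z = \sum_i dot z (w i) *: w i.
Proof.
move=> /orthonormal_mulmxT/mulmx1C ww; rewrite -{1}[z]mulmx1 -ww mulmxA mulmx_sum_row.
by apply: eq_bigr => i _; rewrite mulmx_trmx_rows rowK.
Qed.

Lemma orthonormal_adj (w : 'I_n -> 'rV[R]_n) (z : 'rV[R]_n) i : orthonormal_basis w ->
  (z *m \adj (\matrix_i w i)) 0 i = \det (\matrix_i w i) * dot z (w i).
Proof.
move=> /orthonormal_mulmxT ww; rewrite -mulmx_trmx_rows.
rewrite -[\adj _]mulmx1 -ww (mulmxA (\adj _)) mul_adj_mx mul_scalar_mx.
by rewrite -scalemxAr mxE.
Qed.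

Lemma orthonormal_det (w : 'I_n -> 'rV[R]_n) : orthonormal_basis w ->
  `|\det (\matrix_i w i)| = 1.
Proof.
move=> /orthonormal_mulmxT ww.
have := congr1 determinant ww; rewrite det_mulmx det_tr det1 -expr2 => /eqP.
by rewrite sqrf_eq1 => /orP[] /eqP ->; rewrite ?normrN normr1.
Qed.

(** If x_j is near plus or minus w_i, then [<u, x_j>] is near a number of [-1, 1] because [u] is in
    the cube; the other [j] carry little mass. Hence u, the sum of the [<u, x_j>] y_j, is near a
    point of [A]. *)
Lemma limit_cube_subset (A : set (l2 R n)) (m : R) : closed A -> 0 <= m ->
    (forall lam, 1 <= lam -> exists F, frame_approx A m lam F) ->
  exists w : 'I_n -> 'rV[R]_n, orthonormal_basis w /\
    [set u : l2 R n | forall i, `|dot u (w i)| <= 1] `<=` A.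
Proof.
move=> cA m0 HF.
have [|F FA] := @choice _ _ (fun p F => frame_approx A m p.+1%:R F).
  by move=> p; apply: HF; rewrite ler1n.
have F1 p i : dot (F p i) (F p i) <= 1 by case: (FA p).
have [w wF] := frame_cluster F1.
have big (a e : R) : 0 < e -> exists p0, forall p, (p0 <= p)%N -> a / p.+1%:R < e.
  move=> e0; exists (Num.truncn (a / e)) => p pp.
  rewrite ltr_pdivrMr// mulrC -ltr_pdivrMr//.
  by apply: lt_le_trans (truncnS_gt _) _; rewrite ler_nat.
have w1 i : dot (w i) (w i) <= 1.
  apply/ler_addgt0Pr => e e0; have [p [_ _ _ /(_ i)]] := wF e 0%N e0.
  rewrite distrC => h; have := le_lt_trans (ler_norm _) h.
  by move=> /ltW; rewrite lerBlDl => /le_trans; apply; rewrite lerD2r.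
have w2 : 1 <= `|\det (\matrix_i w i)|.
  apply/ler_addgt0Pr => e e0; have e20 : 0 < e / 2 by rewrite divr_gt0.
  have [p0 hp0] := big 1 _ e20.
  have [p [/hp0 pe /ltW h _ _]] := wF _ p0 e20; have [_ + _] := FA p.
  rewrite -ltr_pdivlMl// mulr1 => hd; rewrite mul1r in pe.
  have := le_trans (ler_dist_dist _ _) h; rewrite ler_norml => /andP[_].
  move: pe hd; set a := p.+1%:R^-1; set d := `|\det _|; set d' := `|\det _|.
  lra.
have ow : orthonormal_basis w by exact: det_ge1_orthonormal.
exists w; split=> // u u1; apply: cA => B /nbhs_ballP[e /= e0 eB].
suff [a [Aa ae]] : exists a, A a /\ l2norm (u - a) < e.
  by exists a; split=> //; apply: eB; rewrite -ball_normE.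
have nw i : l2norm (w i) = 1 by rewrite /l2norm ow eqxx sqrtr1.
have un : l2norm u <= n%:R.
  rewrite {1}(orthonormal_expand u ow); apply: le_trans (l2norm_sum _ _ _) _.
  apply: (@le_trans _ _ (\sum_(i < n) 1)); last by rewrite sumr_const card_ord.
  by apply: ler_sum => i _; rewrite l2normZ nw mulr1.
(* This [D] makes s = e/D satisfy both s <= 1 and n m s <= e/2, even when [m] is 0; [s] is the
   allowed distance from x_j to plus or minus w_i. *)
pose D : R := e + 2 * (n%:R * m).
have D0 : 0 < D by rewrite ltr_wpDr// !mulr_ge0.
pose s := e / D.
have s0 : 0 < s by rewrite divr_gt0.
have s1 : s <= 1 by rewrite ler_pdivrMr// mul1r lerDl !mulr_ge0.
have nms : n%:R * m * s <= e / 2.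
  rewrite /s mulrA ler_pdivrMr// (_ : e / 2 * D = n%:R * m * e + e * e / 2).
    by rewrite lerDl divr_ge0// mulr_ge0 ?ltW.
  by rewrite /D; field.
(* For vectors of norm at most 1, [1 - kap <= |<x, w>|] forces the squared distance from x to plus
   or minus w to be at most 2 kap = s^2. *)
pose kap := s ^+ 2 / 2.
have kap0 : 0 < kap by rewrite divr_gt0// exprn_gt0.
have kap1 : kap <= 1 / 2.
  by rewrite ler_pM2r// exprn_ile1// ltW.
(* The [n] adjugate entries then cost at most kap/2, which leaves a defect of kap/2 for [yJ]. *)
pose eps : R := kap / 2 / n.+1%:R.
have eps0 : 0 < eps by apply: divr_gt0 => //; exact: divr_gt0.
have neps : n%:R * eps <= kap / 2.
  by rewrite /eps mulrA ler_pdivrMr// mulrC ler_pM2l ?ler_nat//; exact: divr_gt0.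
(* The errors that vanish with [p]: the mass on [J], multiplied by the bound [n] of |u|, and the
   factor [c^-1]. *)
have [p0 hp0] := big (n%:R * (2 / kap) + m) _ (divr_gt0 e0 (@ltr0n R 2)).
have [p [/hp0 plarge _ adjp _]] := wF eps p0 eps0.
have [_ _ [N [x [y [c [[x1 xy] ym /andP[c1 cp] yA yJ]]]]]] := FA p.
set lam : R := p.+1%:R in plarge cp yJ.
have lam0 : 0 < lam by rewrite ltr0n.
have c0 : 0 < c by exact: lt_trans c1.
pose J := [set j | [forall i, `|dot (x j) (w i)| < 1 - kap]]%SET.
have SJ : \sum_(j in J) l2norm (y j) <= (kap / 2 * lam)^-1.
  apply: yJ => [|j i]; first by rewrite divr_gt0.
  rewrite inE => /forallP/(_ i) xjw.
  have : `|(x j *m \adj (\matrix_k F p k)) 0 i| <= `|dot (x j) (w i)| + n%:R * eps.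
    rewrite -[\adj _](subrK (\adj (\matrix_k w k))) mulmxDr mxE orthonormal_adj// addrC.
    apply: le_trans (ler_normD _ _) _; rewrite normrM orthonormal_det// mul1r lerD2l.
    rewrite mxE; apply: le_trans (ler_norm_sum _ _ _) _.
    apply: (@le_trans _ _ (\sum_(l < n) eps)); last first.
      by rewrite sumr_const card_ord -[leLHS]mulr_natl.
    apply: ler_sum => l _; rewrite normrM -[leRHS]mul1r ler_pM//.
      by apply: le_trans (l2norm_coord _ _) (l2norm_le1 (x1 j)).
    exact/ltW/adjp.
  move: neps xjw; set q := n%:R * eps; set r := `|dot _ _|; set z := `|_|; lra.
(* The value 0 is taken exactly for [j] in [J]. *)
pose tt j := if [pick i | 1 - kap <= `|dot (x j) (w i)|] is Some i
  then dot u (w i) * Num.sg (dot (x j) (w i)) else 0.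
have tt1 j : `|tt j| <= 1.
  rewrite /tt; case: pickP => [i hi|_]; last by rewrite normr0.
  rewrite normrM; apply: le_trans (u1 i); rewrite ler_piMr// normr_sg.
  by rewrite lern1; case: (_ != _).
have ttJ j : `|dot u (x j) - tt j| <= n%:R * s + n%:R * (j \in J)%:R.
  have [s0' n0] : 0 <= n%:R * s /\ 0 <= n%:R :> R by split=> //; rewrite mulr_ge0// ltW.
  rewrite /tt; case: pickP => [i hi|nopick].
    have -> : (j \in J) = false.
      apply/negbTE; rewrite inE; apply/forallPn; exists i; by rewrite -leNgt.
    rewrite mulr0 addr0.
    have -> : dot u (x j) - dot u (w i) * Num.sg (dot (x j) (w i)) =
       dot u (x j - Num.sg (dot (x j) (w i)) *: w i : 'rV[R]_n).
      by rewrite dotDr dotNr dotZr mulrC.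
    apply: le_trans (norm_dot_le _ _) _; apply: ler_pM => //; try exact: l2norm_ge0.
    rewrite -(@ler_pXn2r _ 2) ?nnegrE ?l2norm_ge0 ?(ltW s0)// sqr_l2norm.
    rewrite dot_sqrD !dotNr [dot (- _) _]dotC dotNr opprK !(dotZr, dotZl) ow eqxx mulr1.
    set r := dot (x j) (w i) in hi *.
    have rn : r != 0.
      by apply/eqP => r0; move: hi; rewrite r0 normr0; lra.
    have -> : Num.sg r * r = `|r| by rewrite -normrEsg.
    have -> : Num.sg r * Num.sg r = 1 by rewrite -expr2 sqr_sg rn.
    have := x1 j; have : s ^+ 2 = 2 * kap by rewrite /kap mulrCA mulfV ?mulr1.
    move: hi; set z := `|r|; rewrite mulr2n; move=> *; lra.
  have -> : j \in J.
    by rewrite inE; apply/forallP => i; rewrite ltNge nopick.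
  rewrite subr0 mulr1; apply: le_trans (norm_dot_le _ _) _.
  apply: (@le_trans _ _ (n%:R * 1)); last by rewrite mulr1 lerDr.
  by apply: ler_pM => //; rewrite ?l2norm_ge0 ?l2norm_le1.
pose v := \sum_j tt j *: y j.
exists (c^-1 *: v); split; first exact: yA.
have uE : u = \sum_j dot u (x j) *: y j.
  rewrite -{1}[u]mulmx1 -xy mulmx_sumr; apply: eq_bigr => j _.
  by rewrite mulmxA mul_rV_trmx.
have uv : l2norm (u - v) <= n%:R * m * s + n%:R * (kap / 2 * lam)^-1.
  rewrite {1}uE /v -sumrB; apply: le_trans (l2norm_sum _ _ _) _.
  apply: (@le_trans _ _ (\sum_j (n%:R * s * l2norm (y j) +
     n%:R * ((j \in J)%:R * l2norm (y j))))).
    apply: ler_sum => j _; rewrite -scalerBl l2normZ.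
    by rewrite [n%:R * (_ * _)]mulrA -mulrDl ler_wpM2r ?l2norm_ge0.
  rewrite big_split /= -!mulr_sumr lerD//.
    by rewrite mulrAC ler_wpM2r ?(ltW s0)// ler_wpM2l.
  rewrite ler_wpM2l//; apply: le_trans SJ; rewrite [leRHS]big_mkcond.
  by apply: ler_sum => j _; case: (j \in J); rewrite ?mul1r ?mul0r.
(* As c > 1, 1 - 1/c is at most c - 1, hence at most 1/lam. *)
have vc : l2norm (v - c^-1 *: v) <= m / lam.
  rewrite -[X in X - _]scale1r -scalerBl l2normZ mulrC ler_pM ?l2norm_ge0//.
    rewrite /v; apply: le_trans (l2norm_sum _ _ _) _; apply: le_trans ym.
    by apply: ler_sum => j _; rewrite l2normZ ler_piMl ?l2norm_ge0.
  rewrite ger0_norm; last by rewrite subr_ge0 invf_le1// ltW.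
  apply: (@le_trans _ _ (c - 1)); last by rewrite lerBlDl.
  rewrite -(ler_pM2r c0) mulrBl mulVf ?gt_eqF// mul1r -subr_ge0.
  by rewrite (_ : _ - _ = (c - 1) ^+ 2) ?sqr_ge0//; ring.
have -> : u - c^-1 *: v = (u - v) + (v - c^-1 *: v) by rewrite addrA subrK.
apply: le_lt_trans (ler_l2normD _ _) _; apply: le_lt_trans (lerD uv vc) _.
have : n%:R * (kap / 2 * lam)^-1 + m / lam = (n%:R * (2 / kap) + m) / lam.
  by rewrite invfM invf_div [RHS]mulrDl -mulrA.
by move=> qE; rewrite -addrA qE (splitr e) ler_ltD.
Qed.

End Limit.

(** * Hahn-Banach theorem *)

Section HahnBanach.
Variable R : realType.

Definition sublinear (V : lmodType R) (p : V -> R) : Prop :=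
  (forall x y, p (x + y) <= p x + p y) /\ forall a x, 0 <= a -> p (a *: x) = a * p x.

(** Serves three infima below: of a chain, of the family that proves a minimal functional additive,
    and of the family that encodes an extension problem. The bound [b] makes the infimum finite. *)
Lemma inf_sublinear (V : lmodType R) (I : Type) (g : I -> V -> R) (i0 : I) (b : V -> R) :
    (forall i x, b x <= g i x) -> 0 <= b 0 -> g i0 0 <= 0 ->
    (forall i j x y, exists k, g k (x + y) <= g i x + g j y) ->
    (forall i a x, 0 < a -> exists k, g k (a *: x) <= a * g i x) ->
  exists q, sublinear q /\ forall i x, q x <= g i x.
Proof.
move=> bg b0 g0 gD gZ; pose q x := inf [set g i x | i in [set: I]].
have hi x : has_inf [set g i x | i in [set: I]].
  by split; [exists (g i0 x), i0|exists (b x) => _ [i _ <-]].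
have qg i x : q x <= g i x by apply: ge_inf; [case: (hi x)|exists i].
have gq x a : (forall i, a <= g i x) -> a <= q x.
  by move=> h; apply: lb_le_inf; [case: (hi x)|move=> _ [i _ <-]].
have q0 : q 0 = 0.
  apply/eqP; rewrite eq_le (le_trans (qg i0 0))//=.
  by apply: gq => i; apply: le_trans b0 _.
have qZ a x : 0 < a -> q (a *: x) <= a * q x.
  move=> a0; rewrite -ler_pdivrMl//; apply: gq => i; rewrite ler_pdivrMl//.
  by have [k] := gZ i a x a0; apply: le_trans.
exists q; split=> //; split=> [x y|a x].
  rewrite -lerBlDr; apply: (gq _ _) => i; rewrite lerBlDr -lerBlDl; apply: gq => j.
  by rewrite lerBlDl; have [k] := gD i j x y; apply: le_trans.
rewrite le_eqVlt => /predU1P[<-|a0]; first by rewrite scale0r mul0r.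
apply/eqP; rewrite eq_le qZ//= -ler_pdivlMl//.
by rewrite -{1}[x](scalerK (lt0r_neq0 a0)) ?qZ ?invr_gt0.
Qed.

Lemma sublinear0 (V : lmodType R) (p : V -> R) : sublinear p -> p 0 = 0.
Proof. by move=> [_ pZ]; rewrite -(scale0r 0) pZ// mul0r. Qed.

Lemma sublinear_ge (V : lmodType R) (p : V -> R) x : sublinear p -> - p (- x) <= p x.
Proof.
move=> sp; rewrite -subr_ge0 opprK; have [pD _] := sp.
by have := pD x (- x); rewrite subrr sublinear0.
Qed.

(** Zorn's lemma for the reversed pointwise order; the infimum of a chain is finite because a
    sublinear s below p satisfies s(x) >= -p(-x). *)
Lemma minimal_sublinear (V : lmodType R) (p : V -> R) : sublinear p ->
  exists q, [/\ sublinear q, forall x, q x <= p x &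
    forall s, sublinear s -> (forall x, s x <= q x) -> forall x, q x <= s x].
Proof.
move=> sp; pose T := {q : V -> R | sublinear q /\ forall x, q x <= p x}.
pose le (s t : T) := `[< forall x, sval t x <= sval s x >].
have t0 : T by exists p.
have [||A totA|t tmin] := @ZL_preorder T t0 le.
- by move=> t; apply/asboolP.
- move=> r s t /asboolP rs /asboolP st; apply/asboolP => x.
  by apply: le_trans (st x) (rs x).
- have [A0|/set0P[s0 As0]] := eqVneq A set0; first by exists t0 => s; rewrite A0.
  pose I := {s : T | A s}.
  have [||||| q [sq qA]] := @inf_sublinear V I (fun s => sval (sval s)) (exist _ s0 As0)
     (fun x => - p (- x)).
  + move=> [s As] x /=; have [ss sp'] := svalP s.
    by apply: le_trans (sublinear_ge x ss); rewrite lerN2.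
  + by rewrite oppr0 sublinear0 ?oppr0.
  + by have [ss _] := svalP s0; rewrite /= sublinear0.
  + move=> [s As] [t At] x y.
    have [/asboolP st|/asboolP ts] := totA s t As At.
      exists (exist _ t At) => /=; have [[tD _] _] := svalP t.
      by apply: le_trans (tD x y) _; rewrite lerD2r.
    exists (exist _ s As) => /=; have [[sD _] _] := svalP s.
    by apply: le_trans (sD x y) _; rewrite lerD2l.
  + move=> [[s [ss sp']] As] a x a0; exists (exist _ (exist _ s (conj ss sp')) As) => /=.
    by have [_ sZ] := ss; rewrite (sZ _ _ (ltW a0)).
  have qp x : q x <= p x.
    by apply: le_trans (qA (exist _ s0 As0) x) _; have [_] := svalP s0; exact.
  exists (exist _ q (conj sq qp)) => s As; apply/asboolP => x /=.
  exact: (qA (exist _ s As)).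
have [st tp] := svalP t; exists (sval t); split=> // s ss sle x.
have sp' y : s y <= p y by apply: le_trans (sle y) (tp y).
pose s' : T := exist _ s (conj ss sp').
have : le t s' by apply/asboolP.
by move=> /tmin/asboolP.
Qed.

(* For [q] minimal, [inf_(t >= 0) q (y + t z) - t q z] is sublinear and below
   [q], hence equal to it; the term [t = 1] gives superadditivity. *)
Lemma minimal_sublinear_linear (V : lmodType R) (q : V -> R) : sublinear q ->
    (forall s, sublinear s -> (forall x, s x <= q x) -> forall x, q x <= s x) ->
  forall a x y, q (a *: x + y) = a * q x + q y.
Proof.
move=> sq qmin; have [qD qZ] := sq.
have add x z : q (x + z) = q x + q z.
  apply/eqP; rewrite eq_le qD/=.
  pose I := {t : R | 0 <= t}; pose i0 : I := exist _ 0 (lexx 0).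
  have [||||| s [ss sg]] := @inf_sublinear V I
    (fun t y => q (y + sval t *: z) - sval t * q z) i0 (fun y => - q (- y)).
  - move=> [t t0] y /=; rewrite lerBrDr -qZ// addrC lerBlDr.
    by have := qD (y + t *: z) (- y); rewrite addrAC subrr add0r.
  - by rewrite oppr0 sublinear0 ?oppr0.
  - by rewrite /= scale0r addr0 mul0r subr0 sublinear0.
  - move=> [t t0] [u u0] y w; exists (exist _ (t + u) (addr_ge0 t0 u0)) => /=.
    rewrite scalerDl addrACA mulrDl opprD [leRHS]addrACA lerD2r; exact: qD.
  - move=> [t t0] a y a0; exists (exist _ (a * t) (mulr_ge0 (ltW a0) t0)) => /=.
    by rewrite -scalerA -scalerDr (qZ _ _ (ltW a0)) mulrBr mulrA.
  have : q x <= s x.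
    apply: qmin => // y; have := sg i0 y.
    by rewrite /= scale0r addr0 mul0r subr0.
  move=> /le_trans/(_ (sg (exist _ 1 ler01) x)).
  by rewrite /= scale1r mul1r lerBrDr.
have qN x : q (- x) = - q x.
  by apply/eqP; rewrite eq_sym -subr_eq0 -opprD oppr_eq0 -add subrr sublinear0.
move=> a x y; rewrite add; congr (_ + _).
have [a0|a0] := leP 0 a; first exact: qZ.
by rewrite -[a]opprK scaleNr qN qZ ?mulNr// oppr_ge0 ltW.
Qed.

(** The infimum over x of |y - J x| + f x is sublinear, at most |y|, and at most f on the image of
    [J]. A minimal functional below it is linear, and two linear functionals that compare are
    equal. *)
Lemma hahn_banach_isometric (X : lmodType R) (Y : normedModType R) (J : {linear X -> Y})
    (f : X -> R) :
    (forall a x y, f (a *: x + y) = a * f x + f y) -> (forall x, f x <= `|J x|) ->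
  exists g : Y -> R, [/\ forall a x y, g (a *: x + y) = a * g x + g y,
    forall y, `|g y| <= `|y| & forall x, g (J x) = f x].
Proof.
move=> fl fJ.
have f0 : f 0 = 0.
  by have := fl 1 0 0; rewrite scale1r addr0 mul1r -{1}[f 0]addr0 => /addrI.
have fZ a x : f (a *: x) = a * f x by rewrite -[a *: x]addr0 fl f0 addr0.
have fD x y : f (x + y) = f x + f y by rewrite -[x in LHS]scale1r fl mul1r.
have fN x : f (- x) = - f x by rewrite -scaleN1r fZ mulN1r.
have [||||| p [sp pg]] := @inf_sublinear Y X (fun x y => `|y - J x| + f x) 0 (fun y => - `|y|).
- move=> x y.
  have h : - f x <= `|J x| by rewrite -fN (le_trans (fJ _))// linearN normrN.
  have h2 : `|J x| <= `|y - J x| + `|y|.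
    by rewrite -{1}(subrK y (J x)) (distrC y) ler_normD.
  lra.
- by rewrite normr0 oppr0.
- by rewrite linear0 subrr normr0 f0 addr0.
- move=> x x' y y'; exists (x + x').
  rewrite fD linearD opprD addrACA [leRHS]addrACA lerD2r; exact: ler_normD.
- move=> x a y a0; exists (a *: x).
  by rewrite linearZ_LR -scalerBr normrZ gtr0_norm// fZ mulrDr.
have [q [sq qp qmin]] := minimal_sublinear sp.
have ql := minimal_sublinear_linear sq qmin.
have qN y : q (- y) = - q y.
  have := ql (-1) y 0; rewrite addr0 scaleN1r => ->.
  by rewrite sublinear0// addr0 mulN1r.
have qle y : q y <= `|y|.
  by apply: le_trans (qp y) _; apply: le_trans (pg 0 y) _; rewrite linear0 subr0 f0 addr0.
have qJ x : q (J x) <= f x.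
  by apply: le_trans (qp _) _; apply: le_trans (pg x _) _; rewrite subrr normr0 add0r.
exists q; split=> // [y|x].
  by rewrite ler_norml qle andbT lerNl -qN (le_trans (qle _))// normrN.
by apply/eqP; rewrite eq_le qJ/= -lerN2 -fN -qN -linearN qJ.
Qed.

End HahnBanach.

(** * Cubes *)

Section Cube.
Variable R : realType.

Definition coord_cube n (z : 'rV[R]_n) (r : R) : set 'rV[R]_n :=
  [set x | forall i, `|x 0 i - z 0 i| <= r].

Lemma coord_cube_closed n (z : 'rV[R]_n) (r : R) : closed (coord_cube z r).
Proof.
have -> : coord_cube z r =
    \bigcap_(i in [set: 'I_n]) [set x | `[z 0 i - r, z 0 i + r]%classic (x 0 i)].
  apply/seteqP; split=> x /= h i; first by rewrite /= in_itv/= -ler_distl.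
  by have := h i I; rewrite /= in_itv/= -ler_distl.
apply: closed_bigI => i _; apply: preimage_closedT; first exact: coord_continuous.
exact: interval_closed.
Qed.

Lemma volume_coord_cube n (z : 'rV[R]_n) (r : R) : 0 <= r ->
  volume (n := n) (coord_cube z r) = ((r *+ 2) ^+ n)%:E.
Proof.
move=> r0; elim: n z => [|n IH] z.
  by rewrite expr0 /volume/= diracE mem_set//= => -[].
have [t [z' ->]] := @cons_rVP R n z.
rewrite /volume.
have -> : @l2_of_Rn R n.+1 @^-1` coord_cube (cons_rV t z') r =
    (`[t - r, t + r]%classic : set R) `*` (@l2_of_Rn R n @^-1` coord_cube z' r).
  apply/seteqP; split=> u; rewrite /coord_cube /= in_itv/= -[row_mx _ _]/(cons_rV u.1 _).
    move=> h; split=> [|i]; last by have := h (lift 0 i); rewrite !cons_rVS.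
    by have := h 0; rewrite !cons_rV0 ler_distl.
  move=> [h1 h2] i; case: (unliftP 0 i) => [j|] ->; first by rewrite !cons_rVS.
  by rewrite !cons_rV0 ler_distl.
have mC : measurable (@l2_of_Rn R n @^-1` coord_cube z' r).
  by apply: measurable_closed; exact: coord_cube_closed.
transitivity (lebesgue_measure (`[(t - r)%R, (t + r)%R]%classic : set R) *
    volume (n := n) (coord_cube z' r))%E; first exact: product_measure1E.
rewrite IH lebesgue_measure_itv /= lte_fin exprS EFinM.
case: ltP => [_|h]; first by congr (_ * _)%E; rewrite -EFinB; congr EFin; ring.
have -> : r = 0 by lra.
by rewrite mul0rn !mul0e.
Qed.

Definition std_cube n : set (l2 R n) := [set x | forall i, `|x 0 i| <= 1].

Lemma volume_std_cube n : volume (@std_cube n) = (2 ^+ n)%:E.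
Proof.
have -> : @std_cube n = coord_cube (0 : 'rV[R]_n) 1.
  by apply/seteqP; split=> x h i; have := h i; rewrite mxE subr0.
by rewrite volume_coord_cube.
Qed.

Lemma std_cube_body n : symmetric_convex_body (@std_cube n).
Proof.
split.
- exists n%:R; split; first exact: realn.
  move=> M nM x x1; apply: le_trans (ltW nM); apply: le_trans (l2norm_le_sum x) _.
  apply: (@le_trans _ _ (\sum_(i < n) 1)); last by rewrite sumr_const card_ord.
  by apply: ler_sum => i _; exact: x1.
- move=> x clx i; apply/ler_addgt0Pr => e e0.
  have [y [y1]] := clx _ (nbhsx_ballx x e e0).
  rewrite -ball_normE /= => xy.
  have h : `|x 0 i - y 0 i| <= e.
    by have := le_trans (l2norm_coord (x - y) i) (ltW xy); rewrite !mxE.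
  rewrite -(subrK (y 0 i) (x 0 i)) addrC; apply: le_trans (ler_normD _ _) _.
  by rewrite lerD.
- move=> x y t; rewrite !inE => x1 y1 i.
  have -> : (conv t x y : 'rV[R]_n) 0 i = t%:num * x 0 i + (1 - t%:num) * y 0 i.
    by rewrite !mxE.
  have t0 : 0 <= t%:num by [].
  have t1 : 0 <= 1 - t%:num by rewrite subr_ge0.
  apply: le_trans (ler_normD _ _) _; rewrite !normrM (ger0_norm t0) (ger0_norm t1).
  apply: (@le_trans _ _ (t%:num * 1 + (1 - t%:num) * 1)).
    by rewrite lerD// ler_wpM2l.
  by rewrite !mulr1 addrC subrK.
- exists 0; apply/nbhs_ballP; exists 1 => //= x; rewrite -ball_normE /= sub0r normrN.
  by move=> /ltW x1 i; apply: le_trans (l2norm_coord _ _) x1.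
- by move=> x x1 i; rewrite mxE normrN.
Qed.

Lemma exists_linear (U V : lmodType R) (f : U -> V) : linear f ->
  exists F : {linear U -> V}, forall x, F x = f x.
Proof.
by move=> lf; pose m := GRing.isLinear.Build R U V _ f lf;
  exists (HB.pack_for {linear U -> V} f m).
Qed.

(** Each coordinate functional extends from the image of [J] to [Y] with norm at most 1; the
    extensions together form the projection. *)
Lemma std_cube_sufficient n : sufficient_enlargement (@std_cube n).
Proof.
split; first exact: std_cube_body.
move=> Y J iJ.
have [|g gP] := @choice 'I_n (Y -> R) (fun i g => [/\ forall a x y, g (a *: x + y) = a * g x + g y,
    forall y, `|g y| <= `|y| & forall x : l2 R n, g (J x) = x 0 i]).
  move=> i; apply: hahn_banach_isometric => [a x y|x]; first by rewrite !mxE.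
  by rewrite iJ; apply: le_trans (ler_norm _) (l2norm_coord _ _).
pose f y : l2 R n := \row_i g i y.
have [|P PE] := @exists_linear Y Y (fun y => J (f y)).
  move=> a x y; rewrite -linearP; congr (J _); apply/rowP => i; rewrite !mxE.
  by have [-> _ _] := gP i.
have fJ x : f (J x) = x.
  by apply/rowP => i; rewrite mxE; have [_ _ ->] := gP i.
exists P; split; last first.
  move=> _ [y y1 <-]; exists (f y); last by rewrite PE.
  by move=> i; rewrite mxE; have [_ gy _] := gP i; apply: le_trans (gy y) y1.
split.
- apply: bounded_linear_continuous; apply/bounded_funP => r; exists (n%:R * r) => y yr.
  rewrite PE iJ; apply: le_trans (l2norm_le_sum _) _.
  apply: (@le_trans _ _ (\sum_(i < n) r)).
    by apply: ler_sum => i _; rewrite mxE; have [_ gy _] := gP i; apply: le_trans (gy y) yr.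
  by rewrite sumr_const card_ord -[leLHS]mulr_natl.
- by move=> y; rewrite !PE fJ.
- apply/seteqP; split=> [_ [y _ <-]|_ [x _ <-]]; first by rewrite PE; exists (f y).
  by exists (J x) => //; rewrite PE fJ.
Qed.

(** Bypasses rotation invariance: Cauchy-Binet for [w] with itself says that the squared
    determinants sum to n!, and as they are at most 1 so do, at least, their absolute values. *)
Lemma orthonormal_zonotope_volume n (w : 'I_n -> 'rV[R]_n) : orthonormal_basis w ->
  ((2 ^+ n)%:E <= volume (n := n) (zonotope w [set: 'I_n]))%E.
Proof.
move=> ow; have := zonotope_volume w [set: 'I_n].
have S : n`!%:R <= \sum_(f : {ffun 'I_n -> 'I_n} | [forall i, f i \in [set: 'I_n]%SET])
    `|\det (\matrix_i w (f i))|.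
  rewrite (eq_bigl predT); last by move=> f; apply/forallP => i; rewrite inE.
  have -> : n`!%:R = n`!%:R * \det (\sum_k (w k)^T *m w k) :> R.
    have -> : \sum_k (w k)^T *m w k = 1%:M.
      apply/row_matrixP => i; apply/rowP => j.
      rewrite -(mulmx1C (orthonormal_mulmxT ow)) !mxE summxE.
      by apply: eq_bigr => k _; rewrite !mxE big_ord1 !mxE.
    by rewrite det1 mulr1.
  rewrite -cauchy_binet; apply: ler_sum => f _.
  rewrite -expr2 -real_normK ?num_real// expr2 ler_piMr//.
  by apply: det_le1 => i; rewrite ow eqxx.
move=> h; rewrite -(@lee_pmul2l _ (n`!%:R)%:E) ?lte_fin ?ltr0n ?fact_gt0//.
by apply: le_trans h; rewrite -EFinM lee_fin mulrC ler_pM2l// exprn_gt0.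
Qed.

Lemma zonotope_orthonormal n (w : 'I_n -> 'rV[R]_n) x i : orthonormal_basis w ->
  zonotope w [set: 'I_n] x -> `|dot x (w i)| <= 1.
Proof.
move=> ow [t t1 ->].
have -> : \sum_(k in [set: 'I_n]%SET) t k *: w k = \sum_k t k *: w k.
  by apply: eq_bigl => k; rewrite inE.
suff -> : dot (\sum_k t k *: w k) (w i) = t i by [].
rewrite dotE mulmx_suml summxE (bigD1 i)//= -scalemxAl mxE -dotE ow eqxx mulr1.
rewrite big1 ?addr0// => k ki.
by rewrite -scalemxAl mxE -dotE ow (negbTE ki) mulr0.
Qed.

(** The homothety of centre [a] and ratio [t] maps the ball about [x0] into [A]; [q] is the preimage
    of [y]. *)
Lemma convex_ball_subset (X : normedModType R) (A : set X) (x0 a : X) (r t : R) :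
    convex_set A -> (forall y, `|y - x0| < r -> A y) -> A a -> 0 < t < 1 ->
  forall y, `|y - (a + t *: (x0 - a))| < t * r -> A y.
Proof.
move=> cA x0A Aa /andP[t0 t1] y yz.
pose q := t^-1 *: (y - a) + a.
have Aq : A q.
  apply: x0A; rewrite -(ltr_pM2l t0) -{1}(gtr0_norm t0) -normrZ.
  apply: le_lt_trans yz; rewrite le_eqVlt; apply/orP; left; apply/eqP; congr `|_|.
  rewrite /q -addrA scalerDr scalerA mulfV ?gt_eqF// scale1r opprD addrA.
  by rewrite -(opprB x0 a) scalerN.
have := cA q a (Itv01 (ltW t0) (ltW t1)); rewrite !inE => /(_ Aq Aa); congr A.
transitivity (t *: q + (1 - t) *: a) => //.
rewrite /q scalerDr scalerA mulfV ?gt_eqF// scale1r scalerBl scale1r.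
by rewrite addrA addrAC addrK subrK.
Qed.

(** The point [a] may lie on the boundary of [A], so it is first moved slightly towards an interior
    point. *)
Lemma body_open_cube n (A : set (l2 R n)) (a w : l2 R n) :
    symmetric_convex_body A -> A a -> 1 < `|dot a w| -> l2norm w <= 1 ->
  exists z (r : R), [/\ 0 < r, coord_cube z r `<=` A &
    forall y, coord_cube z r y -> 1 < `|dot y w|].
Proof.
move=> [_ _ cA [x0 Ax0] _] Aa aw w1.
have /nbhs_ballP[r /= r0 rA] := Ax0.
have x0A (y : l2 R n) : `|y - x0| < r -> A y.
  by move=> yx; apply: rA; rewrite -ball_normE /= distrC.
pose g := `|dot a w| - 1; have g0 : 0 < g by rewrite subr_gt0.
pose K := `|dot (x0 - a) w|; have K0 : 0 <= K by exact: normr_ge0.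
(* The move costs at most g/2 and the size of the cube at most g/4, less than the excess [g]
   together. *)
pose D := g + 2 * (1 + K); have D0 : 0 < D by rewrite /D; lra.
pose t := g / D.
have t0 : 0 < t by rewrite divr_gt0.
have t1 : t < 1 by rewrite ltr_pdivrMr// mul1r /D; lra.
have tK : t * K <= g / 2.
  rewrite /t mulrAC ler_pdivrMr// mulrAC -mulrA ler_pM2l// /D; lra.
pose z : l2 R n := a + t *: (x0 - a).
have zA := convex_ball_subset cA x0A Aa (introT andP (conj t0 t1)).
pose s := Num.min (t * r / 2) (g / 4).
have s0 : 0 < s by rewrite lt_min !divr_gt0// mulr_gt0.
exists z, (s / n.+1%:R).
have near y : coord_cube z (s / n.+1%:R) y -> l2norm (y - z) <= s.
  move=> yz; apply: le_trans (l2norm_le_sum _) _.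
  apply: (@le_trans _ _ (\sum_(i < n) (s / n.+1%:R))).
    by apply: ler_sum => i _; rewrite mxE [X in _ + X]mxE; exact: yz.
  rewrite sumr_const card_ord -[leLHS]mulr_natl mulrA ler_pdivrMr// mulrC.
  by rewrite ler_pM2l// ler_nat.
split; first by rewrite divr_gt0.
  move=> y /near yz; apply: zA; apply: le_lt_trans yz _.
  rewrite gt_min; apply/orP; left; rewrite ltr_pdivrMr// mulr2n mulrDr mulr1 ltrDl.
  exact: mulr_gt0.
move=> y /near yz.
have E : dot a w = dot y w - dot (y - z) w - t * dot (x0 - a) w.
  have -> : dot y w = dot (y - z) w + dot z w by rewrite -dotDl subrK.
  have -> : dot z w = dot a w + t * dot (x0 - a) w by rewrite dotDl dotZl.
  by ring.
have h1 : `|dot (y - z) w| <= g / 4.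
  apply: le_trans (norm_dot_le _ _) _.
  apply: (@le_trans _ _ (s * 1)).
    by apply: ler_pM => //; exact: l2norm_ge0.
  by rewrite mulr1 ge_min lexx orbT.
have h2 : `|t * dot (x0 - a) w| <= g / 2 by rewrite normrM (gtr0_norm t0).
have h3 : `|dot a w| <= `|dot y w| + `|dot (y - z) w| + `|t * dot (x0 - a) w|.
  by rewrite E; apply: le_trans (ler_normB _ _) _; rewrite lerD2r ler_normB.
move: h1 h2 h3; rewrite /g; lra.
Qed.

End Cube.

Theorem theorem7 (R : realType) (n : nat) (A : set (l2 R n))
    (hA : minimal_volume_sufficient_enlargement A) :
  circumscribed_cube A.
Proof.
have [sA minA] := hA.
have vA : (volume A <= (2 ^+ n)%:E)%E.
  by rewrite -(volume_std_cube R n); exact/minA/std_cube_sufficient.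
have [bodyA _] := sA; have [_ cA _ _ _] := bodyA.
have [m [m0 approx]] := enlargement_frame_approx sA vA.
have [w [ow wA]] := limit_cube_subset cA m0 approx.
exists w; split=> //; apply/seteqP; split=> [a Aa i|]; last exact: wA.
rewrite leNgt; apply/negP => aw.
have w1 : l2norm (w i) <= 1 by apply: l2norm_le1; rewrite ow eqxx.
have [z [r [r0 zA zw]]] := body_open_cube bodyA Aa aw w1.
have mZ : measurable (@l2_of_Rn R n @^-1` zonotope w [set: 'I_n]).
  by apply: measurable_closed; exact: zonotope_closed.
have mB : measurable (@l2_of_Rn R n @^-1` coord_cube z r).
  by apply: measurable_closed; exact: coord_cube_closed.
(* The cube of [w] enters as a zonotope, for which the lower bound 2^n is available; the small cube
   lies outside the slab of [w i], so the two are disjoint. *)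
have : (volume (n := n) (zonotope w [set: 'I_n]) + volume (n := n) (coord_cube z r) <=
    volume A)%E.
  rewrite /volume -measureU//; last first.
    apply/seteqP; split=> // u [/= uZ uB].
    by have := zw _ uB; rewrite ltNge (zonotope_orthonormal i ow uZ).
  apply: le_measure; rewrite ?inE; [exact: measurableU| |].
    by apply: measurable_closed; exact: closed_l2_rV.
  move=> u [/= uZ|/zA//]; apply: wA => k; exact: zonotope_orthonormal uZ.
move=> /le_trans/(_ vA); rewrite leNgt => /negP; apply.
apply: (@lt_le_trans _ _ ((2 ^+ n)%:E + ((r *+ 2) ^+ n)%:E)%E).
  by rewrite -EFinD lte_fin ltrDl exprn_gt0// pmulrn_lgt0.
rewrite (volume_coord_cube _ (ltW r0)); apply: leeD => //.
exact: orthonormal_zonotope_volume.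
Qed.
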